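(* Let $k,\lambda,\beta>0$ and let $X$ be a $\Gamma$-OU$(k,\lambda,\beta)$ process. For $s\ge 0$ and $t>0$, the transition density $p(x,t+s\,|\,y,s)$ of $X$ (the generalized density in $x$ of the law of $X(t+s)$ conditional on $X(s)=y$) is $$p(x,t+s\,|\,y,s)=g_a\left(x-ay,\frac{\lambda}{k},\beta\right),\qquad a=e^{-kt},$$ where, for $\alpha>0$, $$g_a(x,\alpha,\beta)=a^\alpha\delta(x)+\sum_{j=1}^\infty\binom{\alpha+j-1}{j}a^\alpha(1-a)^j f_{j,\beta/a}(x).$$
   Context: A $\Gamma$-OU$(k,\lambda,\beta)$ process is the solution of $dX(t)=-kX(t)\,dt+dZ(t)$, $X(0)=x_0$, where $Z(t)=\sum_{n=1}^{N(t)}J_n$ is a compound Poisson process: $N$ is a Poisson process with intensity $\lambda$ and the jumps $J_n$ are i.i.d. exponential with rate $\beta$, independent of $N$. Equivalently, $X(t)=x_0e^{-kt}+\sum_{n=1}^{N(t)}e^{-k(t-\tau_n)}J_n$ with $\tau_n$ the jump times of $N$. Here $f_{j,b}(x)=\frac{b}{(j-1)!}(bx)^{j-1}e^{-bx}$ for $x>0$ (and $0$ otherwise) is the density of the Erlang law with shape $j$ and rate $b$; $\binom{\alpha+j-1}{j}=\frac{\alpha(\alpha+1)\cdots(\alpha+j-1)}{j!}$; and $\delta$ is the Dirac delta at $0$, so a term $c\,\delta(x)$ denotes an atom of mass $c$ at $0$. *)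

(* Defs.v *)
From HB Require Import structures.
From mathcomp Require Import all_boot all_order all_algebra.
From mathcomp Require Import all_classical all_reals all_analysis.

Set Implicit Arguments.
Unset Strict Implicit.
Unset Printing Implicit Defensive.

Import Order.TTheory GRing.Theory Num.Theory.
Import numFieldNormedType.Exports.

Local Open Scope classical_set_scope.
Local Open Scope ring_scope.

Section independence.
Context {d d' : measure_display} {R : realType}.
Context {T : measurableType d} {T' : measurableType d'}.
Variable P : probability T R.

(* Independence of the whole family: the product rule over every finite
   subfamily, the latter being enumerated by a duplicate-free list. *)
Definition mutually_independent (I : eqType) (X : I -> T -> T') :=
  forall (s : seq I) (B : I -> set T'), uniq s ->
    (forall i, measurable (B i)) ->
    P (\bigcap_(i in [set` s]) (X i @^-1` B i)) =
    (\prod_(i <- s) P (X i @^-1` B i))%E.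

(* The sigma-algebra on T generated by the X i, for i in D. *)
Definition sigma_generated (I : Type) (D : set I) (X : I -> T -> T') :
    set (set T) :=
  <<s [set A | exists i B, [/\ D i, measurable B & A = X i @^-1` B]] >>.

End independence.

Definition independent_sigma {d} {R : realType} {T : measurableType d}
    (P : probability T R) (F G : set (set T)) :=
  forall A B, F A -> G B -> P (A `&` B) = (P A * P B)%E.

Section gamma_OU.
Context {d : measure_display} {R : realType} {Omega : measurableType d}.
Variable P : probability Omega R.

(* Only the values at times t >= 0 matter. An infinite nondecreasing sequence
   of times encodes every finite one (make it eventually constant), and the
   truncated subtraction in nat is harmless because almost all paths are
   nondecreasing. [poisson_pmf] is not the Poisson law at rate 0, whence the
   strict s < t. *)
Definition poisson_process (lambda : R) (N : R -> {RV P >-> nat}) :=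
  [/\ {ae P, forall w,
         [/\ N 0 w = 0%N,
             (forall s t, 0 <= s -> s <= t -> (N s w <= N t w)%N) &
             (forall t, 0 <= t -> N u w @[u --> t^'+] --> N t w)]},
      (forall tau : nat -> R, 0 <= tau 0%N ->
         {homo tau : i j / (i <= j)%N >-> i <= j} ->
         mutually_independent P
           (fun i w => (N (tau i.+1) w - N (tau i) w)%N)) &
      (forall s t n, 0 <= s -> s < t ->
         P [set w | (N t w - N s w)%N = n] =
         (poisson_pmf (lambda * (t - s)) n)%:E)].

Definition iid_exponential (beta : R) (J : nat -> {RV P >-> R}) :=
  mutually_independent P J /\
  forall n (B : set R), measurable B ->
    distribution P (J n) B = exponential_prob beta B.

(* The jump J_n is [J n.-1], for n >= 1. *)
Definition compound_poisson (N : R -> {RV P >-> nat}) (J : nat -> {RV P >-> R})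
    (t : R) (w : Omega) : R :=
  \sum_(n < N t w) J n w.

(* X is driven by Z: dX(t) = - k X(t) dt + dZ(t), X(0) = x0, in integrated
   form; Z has paths of bounded variation, so the equation is pathwise. *)
Definition OU_solution (k x0 : R) (Z : R -> Omega -> R)
    (X : R -> {RV P >-> R}) :=
  {ae P, forall w, forall t, 0 <= t ->
     lebesgue_measure.-integrable `[0, t] (fun u => (X u w)%:E) /\
     X t w = x0 - k * \int[lebesgue_measure]_(u in `[0, t]) X u w + Z t w}.

Definition gamma_OU (k lambda beta x0 : R) (X : R -> {RV P >-> R}) :=
  exists (N : R -> {RV P >-> nat}) (J : nat -> {RV P >-> R}),
    [/\ poisson_process lambda N,
        iid_exponential beta J,
        independent_sigma P (sigma_generated [set t | 0 <= t] N)
                            (sigma_generated setT J) &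
        OU_solution k x0 (compound_poisson N J) X].

End gamma_OU.

Section generalized_density.
Context {R : realType}.

(* [GDensity c m h] stands for x |-> m * delta(x - c) + h(x). *)
Record gdensity := GDensity {
  gd_atom : R ;
  gd_mass : R ;
  gd_ac : R -> \bar R }.

(* x |-> g (x - c) *)
Definition gd_shift (g : gdensity) (c : R) : gdensity :=
  GDensity (gd_atom g + c) (gd_mass g) (fun x => gd_ac g (x - c)).

Definition gd_measure (g : gdensity) (B : set R) : \bar R :=
  ((gd_mass g)%:E * \d_(gd_atom g) B +
   \int[lebesgue_measure]_(x in B) gd_ac g x)%E.

(* p y is the generalized density of the law of Y conditional on X = y:
   the p y are the densities of a regular conditional distribution of Y
   given X. *)
Definition conditional_gdensity {d} {Omega : measurableType d}
    (P : probability Omega R) (Y X : {RV P >-> R}) (p : R -> gdensity) :=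
  exists kappa : R.-pker R ~> R,
    (forall y (B : set R), measurable B -> kappa y B = gd_measure (p y) B) /\
    (forall A B : set R, measurable A -> measurable B ->
       P (X @^-1` A `&` Y @^-1` B) =
       (\int[distribution P X]_(y in A) kappa y B)%E).

(* Erlang density with shape j >= 1 and rate b. *)
Definition erlang_pdf (j : nat) (b x : R) : R :=
  if 0 < x then b / (j.-1)`!%:R * (b * x) ^+ j.-1 * expR (- (b * x)) else 0.

(* binom(alpha + j - 1, j) = alpha (alpha + 1) ... (alpha + j - 1) / j! *)
Definition rising_binomial (alpha : R) (j : nat) : R :=
  (\prod_(i < j) (alpha + i%:R)) / j`!%:R.

(* The terms of the series are nonnegative for 0 < a < 1, so it is summed
   in the extended reals. *)
Definition g_density (a alpha beta : R) : gdensity :=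
  GDensity 0 (a `^ alpha)
    (fun x => \sum_(1 <= j <oo)
       (rising_binomial alpha j * a `^ alpha * (1 - a) ^+ j *
        erlang_pdf j (beta / a) x)%:E)%E.

End generalized_density.

(* Main.v *)
Require Import Defs.
From HB Require Import structures.
From mathcomp Require Import all_boot all_order all_algebra.
From mathcomp Require Import ring lra measurable_realfun.
From mathcomp Require Import all_classical all_reals all_analysis.

Set Implicit Arguments.
Unset Strict Implicit.
Unset Printing Implicit Defensive.

Import Order.TTheory GRing.Theory Num.Theory.
Import numFieldNormedType.Exports.

Local Open Scope classical_set_scope.
Local Open Scope ring_scope.

(** Put a = exp(-kt), U = X(s) - exp(-ks) x0 and W = X(t+s) - a X(s). Solving the
    equation pathwise, U and W are limits of Riemann-Stieltjes sums of the driving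
    compound Poisson process over [0, s] and [s, s+t]. The increments of that
    process have the joint Laplace transform
    prod_i exp(lambda (t_(i+1) - t_i) (beta / (beta + c_i) - 1)), so, passing to the
    limit, E exp(-(eta U + theta W)) is the product of E exp(-eta U) and of
    exp(-lambda int_0^t theta e^(-ku) / (beta + theta e^(-ku)) du)
    = ((beta + a theta) / (beta + theta))^(lambda/k).
    By the negative binomial series the last factor is also the Laplace transform
    of g_a. Since a finite measure on the half-line is determined by its Laplace
    transform at the natural numbers, U and W are independent and W has law g_a. *)

(** * Laplace transforms of measures on the half-line *)

(** The hypotheses describe [N] through its increments and not through jump times, so the closed
    formula for X in terms of the jump times is not at hand; Riemann-Stieltjes sums involve the
    driving process only at grid points, where joint laws are known. Subtracting exp(-ks) x0 from
    X(s) makes U, like W, an almost sure limit of nonnegative sums whatever the sign of x0.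
    Nonnegativity bounds every exponential by 1, which gives dominated convergence, and places both
    laws on the half-line. The law of U is never computed: its transform only has to factor out. As
    X(t+s) = a X(s) + W and X(s) is a constant shift of U, independence of U and W makes the
    transition kernel the family of translates by a y of one fixed measure. Independence is reached
    by applying the one-dimensional uniqueness to one variable at a time, which is why uniqueness is
    stated for finite measures instead of probabilities. *)

Section weighted_measure.
Local Open Scope ereal_scope.
Context d d' (T : measurableType d) (T' : measurableType d') (R : realType).
Variables (mu : {measure set T -> \bar R}) (phi : T -> T') (g : T -> R).
Hypotheses (mphi : measurable_fun setT phi) (mg : measurable_fun setT g).
Hypothesis g0 : forall x, (0 <= g x)%R.

(** Image under [phi] of the measure with density [g] with respect to [mu]. Push-forwards ([g] = 1),
    measures with a density ([phi] = id) and multiples ([g] constant) are all instances. The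
    hypotheses are arguments so that the measure structure can be attached to the definition
    itself. *)
Definition weighted_image of measurable_fun setT phi & measurable_fun setT g &
    (forall x, (0 <= g x)%R) :=
  fun A : set T' => \int[mu]_(x in phi @^-1` A) (g x)%:E.

Local Notation nu := (weighted_image mphi mg g0).

Let mpre A : measurable A -> measurable (phi @^-1` A).
Proof. by move=> mA; rewrite -[X in measurable X]setTI; exact: mphi. Qed.

Let nu0 : nu set0 = 0. Proof. by rewrite /weighted_image preimage_set0 integral_set0. Qed.

Let nu_ge0 A : 0 <= nu A.
Proof. by apply: integral_ge0 => x _; rewrite lee_fin. Qed.

Let nu_sigma_additive : semi_sigma_additive nu.
Proof.
move=> F mF tF mUF; rewrite /weighted_image preimage_bigcup.
apply: (@semi_sigma_additive_nng_induced _ _ _ mu (EFin \o g)).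
- exact/measurable_EFinP.
- by move=> x; rewrite lee_fin.
- by move=> n; exact: mpre.
- apply/trivIsetP => /= i j _ _ ij; rewrite -preimage_setI.
  by move/trivIsetP : tF => /(_ _ _ _ _ ij) ->//; rewrite preimage_set0.
- by rewrite -preimage_bigcup; exact: mpre.
Qed.

HB.instance Definition _ := isMeasure.Build _ _ _ nu
  nu0 nu_ge0 nu_sigma_additive.

Import HBNNSimple.

(** Both sides are monotone limits along the simple approximations [h n] of [f]; for a simple
    function, both reduce to the sum over its values y of y times the mass [nu] gives to the level
    set of y. *)
Lemma ge0_integral_weighted (f : T' -> \bar R) :
  measurable_fun setT f -> (forall x, 0 <= f x) ->
  \int[nu]_x f x = \int[mu]_x (f (phi x) * (g x)%:E).
Proof.
move=> mf f0; pose h := nnsfun_approx measurableT mf.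
have f0' x : setT x -> 0 <= f x by [].
have hf x : (h n x)%:E @[n --> \oo] --> f x by exact: cvg_nnsfun_approx.
have hnd x a b : (a <= b)%N -> (h a x <= h b x)%R.
  by move=> ab; exact/lefP/nd_nnsfun_approx.
have mhphi n : measurable_fun setT (h n \o phi) by exact: measurableT_comp.
have -> : \int[nu]_x f x = lim (\int[nu]_x (h n x)%:E @[n --> \oo]).
  rewrite -monotone_convergence//.
  - by apply: eq_integral => x _; apply/esym/cvg_lim.
  - by move=> n; apply/measurable_EFinP/measurable_funP.
  - by move=> n x _; rewrite lee_fin.
  - by move=> x _ a b ab; rewrite lee_fin hnd.
have -> : \int[mu]_x (f (phi x) * (g x)%:E) =
    lim (\int[mu]_x ((h n (phi x))%:E * (g x)%:E) @[n --> \oo]).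
  rewrite -monotone_convergence//.
  - apply: eq_integral => x _; apply/esym/cvg_lim => //.
    by apply: cvgeZr => //; exact: hf.
  - move=> n; apply: emeasurable_funM; last exact/measurable_EFinP.
    by apply/measurable_EFinP; exact: mhphi.
  - by move=> n x _; rewrite mule_ge0 ?lee_fin.
  - by move=> x _ a b ab; rewrite lee_wpmul2r ?lee_fin// hnd.
apply: congr_lim; apply/funext => n.
have mind r : measurable_fun setT
    (fun x => (r * \1_(h n @^-1` [set r]) (phi x))%:E).
  apply/measurable_EFinP; apply: measurable_funM => //.
  exact: (measurableT_comp (measurable_indic _)).
transitivity (\int[nu]_x
   (\sum_(y \in range (h n)) (y * \1_(h n @^-1` [set y]) x)%:E)).
  by apply: eq_integral => x _; rewrite /= fimfunE -fsumEFin.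
rewrite ge0_integral_fsum//; first last.
- by move=> r x _; exact: nnfun_muleindic_ge0.
- by move=> r; apply/measurable_EFinP; exact: measurable_funM.
transitivity (\int[mu]_x (\sum_(y \in range (h n))
    (y * \1_(h n @^-1` [set y]) (phi x))%:E * (g x)%:E)); last first.
  apply: eq_integral => x _.
  rewrite -ge0_mule_fsuml => [|y]; last exact: nnfun_muleindic_ge0.
  by rewrite fsumEFin // -(fimfunE _ (phi x)).
rewrite ge0_integral_fsum//; first last.
- move=> r x _; apply: mule_ge0; last by rewrite lee_fin.
  exact: nnfun_muleindic_ge0.
- by move=> r; apply: emeasurable_funM => //; exact/measurable_EFinP.
apply: eq_fsbigr => r rh.
under eq_integral do rewrite EFinM.
rewrite integralZl_indic_nnsfun//.
under [RHS]eq_integral do rewrite EFinM -muleA.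
rewrite [RHS]ge0_integralZl//.
- rewrite integral_indic// setIT /weighted_image /=; congr (_ * _).
  rewrite [LHS]integral_mkcond; apply: eq_integral => x _.
  by rewrite epatch_indic muleC.
- apply: emeasurable_funM; last exact/measurable_EFinP.
  apply/measurable_EFinP; exact: (measurableT_comp (measurable_indic _)).
- by move=> x _; rewrite mule_ge0 ?lee_fin ?g0.
- by move: rh; rewrite inE => -[t _ <-]; rewrite lee_fin.
Qed.

End weighted_measure.

Lemma measurable_decay (R : realType) (c : R) :
  measurable_fun setT (fun x : R => expR (- (c * x))).
Proof.
by apply: measurableT_comp => //; apply: measurableT_comp => //; exact: measurable_funM.
Qed.

Section laplace_uniqueness.
Context {R : realType}.
Implicit Types (c x : R) (n : nat).

(* Powers large enough to kill e^(-n x) for x <= c, yet so small that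
   (1 - e^(-n x))^p --> 1 for x > c. *)
Definition threshold_pow c n := (Num.truncn (n.+1%:R * expR (c * n.+1%:R))).+1.

(** Write N = n + 1, u = e^(-N x), and p for the power, which is about N e^(cN). Then (1 - u)^p
    behaves like e^(-pu) with pu about N e^(N (c - x)): this tends to 0 for x > c and is at least N
    for x <= c, so the boundary point c falls outside the limiting ray. *)
Lemma threshold_cvg c x : 0 <= c -> 0 <= x ->
  (1 - expR (- (n.+1%:R * x))) ^+ threshold_pow c n @[n --> \oo] -->
  (\1_(`]c, +oo[ : set R) x : R).
Proof.
move=> c0 x0.
have u01 n : 0 <= 1 - expR (- (n.+1%:R * x)) <= 1.
  rewrite subr_ge0 lerBlDr lerDl expR_ge0 andbT -[leRHS](@expR0 R) ler_expR.
  by rewrite oppr_le0 mulr_ge0.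
have [cx|xc] := ltP c x.
  rewrite indicE mem_set/=; last by rewrite in_itv/= cx.
  have d0 : 0 < x - c by rewrite subr_gt0.
  (* By Bernoulli the defect is at most p u. With p <= 2 N e^(cN) and y = N (x - c) this is at most
     2 N / e^y, and e^y >= (y / 2)^2 turns it into 8 / ((x - c)^2 N). *)
  have lb n : 1 - 8 / (x - c) ^+ 2 * n.+1%:R^-1 <=
      (1 - expR (- (n.+1%:R * x))) ^+ threshold_pow c n.
    have := u01 n; set u := expR _ => /andP[u1 _].
    have bern p : 1 - p%:R * u <= (1 - u) ^+ p.
      elim: p => [|p IH]; first by rewrite mul0r subr0 expr0.
      rewrite exprS; apply: le_trans (ler_wpM2l u1 IH).
      rewrite -natr1 mulrDl mul1r mulrBl mul1r mulrBr mulr1.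
      have : 0 <= p%:R * u * u by rewrite !mulr_ge0// expR_ge0.
      by move=> ?; lra.
    apply: le_trans (bern _); rewrite lerB//.
    set N := n.+1%:R : R; have N1 : 1 <= N by rewrite ler1n.
    have N0 : 0 < N by lra.
    apply: (@le_trans _ _ (2 * N * expR (c * N) * u)).
      rewrite ler_wpM2r ?expR_ge0// /threshold_pow -natr1 -/N.
      have h : (Num.truncn (N * expR (c * N)))%:R <= N * expR (c * N).
        by rewrite truncn_le mulr_ge0 ?expR_ge0 ?ltW.
      have : 1 <= N * expR (c * N).
        rewrite -[leLHS]mulr1 ler_pM// -[leLHS](@expR0 R) ler_expR.
        by rewrite mulr_ge0// ltW.
      by move=> ?; lra.
    rewrite -mulrA -expRD.
    have -> : c * N + - (N * x) = - (N * (x - c)) by ring.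
    rewrite expRN -mulrA mulrCA.
    set y := N * (x - c).
    have y0 : 0 < y by rewrite mulr_gt0.
    have ey : (y / 2) ^+ 2 <= expR y.
      have -> : expR y = expR (y / 2) ^+ 2 by rewrite -expRM_natl; congr expR; lra.
      rewrite lerXn2r ?nnegrE ?expR_ge0//; first lra.
      by have := expR_ge1Dx (y / 2); lra.
    rewrite -subr_ge0.
    have -> : 8 / (x - c) ^+ 2 * N^-1 = N * (2 / (y / 2) ^+ 2).
      by rewrite /y; field; rewrite !gt_eqF.
    rewrite subr_ge0 ler_pM2l// ler_pM2l// lef_pV2 ?posrE ?expR_gt0//.
    by rewrite exprn_gt0// divr_gt0.
  apply: (@squeeze_cvgr _ _ _ _ (fun n => 1 - 8 / (x - c) ^+ 2 * n.+1%:R^-1)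
     (fun=> 1)); last 2 first.
  - rewrite -[X in _ --> X]subr0; apply: cvgB; first exact: cvg_cst.
    rewrite -(mulr0 (8 / (x - c) ^+ 2)); apply: cvgMr; exact: cvg_harmonic.
  - exact: cvg_cst.
  apply: nearW => n; rewrite lb /=.
  by have /andP[a b] := u01 n; exact: exprn_ile1.
rewrite indicE memNset/=; last by rewrite in_itv/= andbT; apply/negP; rewrite -leNgt.
apply: (@squeeze_cvgr _ _ _ _ (fun=> 0) (fun n => n.+1%:R^-1)); last 2 first.
- exact: cvg_cst.
- exact: cvg_harmonic.
apply: nearW => n; have /andP[u0 u1] := u01 n; rewrite exprn_ge0//=.
set N := n.+1%:R : R; have N0 : 0 < N by rewrite ltr0n.
(* From 1 - u <= e^(-u), the power is at most 1 / e^(pu) <= 1 / (1 + pu), and pu >= N because x <=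
   c. *)
apply: (@le_trans _ _ (expR (- expR (- (N * x))) ^+ threshold_pow c n)).
  by rewrite lerXn2r ?nnegrE ?expR_ge0//; exact: expR_ge1Dx.
rewrite -expRM_natl mulrN [leLHS]expRN lef_pV2 ?posrE ?expR_gt0//.
apply: le_trans (expR_ge1Dx _); rewrite -[leLHS]add0r lerD//.
apply: (@le_trans _ _ (N * expR (c * N) * expR (- (N * x)))).
  rewrite -mulrA -expRD -[leLHS]mulr1 ler_pM2l//.
  rewrite -[leLHS](@expR0 R) ler_expR.
  by rewrite [c * N]mulrC -mulrBr mulr_ge0 ?subr_ge0// ltW.
by rewrite ler_wpM2r ?expR_ge0// ltW// truncnS_gt.
Qed.

Variables m1 m2 : {measure set R -> \bar R}.
Hypotheses (fin1 : (m1 setT < +oo)%E) (fin2 : (m2 setT < +oo)%E).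
Hypotheses (neg1 : m1 `]-oo, 0[%classic = 0%E) (neg2 : m2 `]-oo, 0[%classic = 0%E).
Hypothesis laplace_eq : forall n,
  (\int[m1]_x (expR (- (n%:R * x)))%:E = \int[m2]_x (expR (- (n%:R * x)))%:E)%E.

Let D : set R := `[0, +oo[.

Let mD : measurable D. Proof. exact: measurable_itv. Qed.

Let restrictE (m : {measure set R -> \bar R}) (f : R -> R) :
  m `]-oo, 0[%classic = 0%E -> measurable_fun setT f -> (forall x, 0 <= f x) ->
  (\int[m]_x (f x)%:E = \int[m]_(x in D) (f x)%:E)%E.
Proof.
move=> m0 mf f0.
rewrite (@ge0_negligible_integral _ _ _ _ _ (`]-oo, 0[ : set R))//; last first.
- by move=> x _; rewrite lee_fin.
- exact/measurable_EFinP.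
by rewrite setTD setCitvl.
Qed.

(** The factor e^(-j x) serves the induction on [p]: expanding one factor 1 - e^(-N x) writes the
    test function for (j, p + 1) as the one for (j, p) minus the one for (j + N, p), so that only
    Laplace transforms at natural numbers enter. *)
Let test j N p (x : R) := expR (- (j%:R * x)) * (1 - expR (- (N%:R * x))) ^+ p.

Let test0 N p x : test 0 N p x = (1 - expR (- (N%:R * x))) ^+ p.
Proof. by rewrite /test mulr0n mul0r oppr0 expR0 mul1r. Qed.

Let mtest j N p : measurable_fun setT (test j N p).
Proof.
apply: measurable_funM; first exact: measurable_decay.
apply: measurable_funX; apply: measurable_funB => //.
exact: measurable_decay.
Qed.

Let test01 j N p x : D x -> 0 <= test j N p x <= 1.
Proof.
rewrite /D/= in_itv/= andbT => x0.
have e1 (n : nat) : expR (- (n%:R * x)) <= 1.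
  by rewrite -[leRHS](@expR0 R) ler_expR oppr_le0 mulr_ge0.
rewrite /test mulr_ge0 ?expR_ge0 ?exprn_ge0 ?subr_ge0 ?e1//=.
rewrite mulr_ile1 ?expR_ge0 ?exprn_ge0 ?subr_ge0 ?e1//=.
by rewrite exprn_ile1 ?subr_ge0 ?e1// lerBlDr lerDl expR_ge0.
Qed.

Let test_integrable (m : {measure set R -> \bar R}) j N p :
  (m setT < +oo)%E -> m.-integrable D (EFin \o test j N p).
Proof.
move=> mT; apply: measurable_bounded_integrable => //.
- by apply: le_lt_trans mT; rewrite le_measure ?inE.
- by apply: measurable_funTS; exact: mtest.
- exists 1; split => // r r1 x Dx /=.
  have /andP[a b] := test01 j N p Dx.
  by rewrite ger0_norm// (le_trans b)// ltW.
Qed.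

Let test_eq j N p :
  (\int[m1]_(x in D) (test j N p x)%:E = \int[m2]_(x in D) (test j N p x)%:E)%E.
Proof.
elim: p j => [|p IH] j.
  have E (m : {measure set R -> \bar R}) :
    (\int[m]_(x in D) (test j N 0 x)%:E =
      \int[m]_(x in D) (expR (- (j%:R * x)))%:E)%E.
    by apply: eq_integral => x _; rewrite /test expr0 mulr1.
  have me := measurable_decay (j%:R : R).
  have e0 (x : R) : 0 <= expR (- (j%:R * x)) by exact: expR_ge0.
  by rewrite !E -(restrictE neg1 me e0) -(restrictE neg2 me e0).

have E (m : {measure set R -> \bar R}) :
    (m setT < +oo)%E -> (\int[m]_(x in D) (test j N p.+1 x)%:E =
    \int[m]_(x in D) (test j N p x)%:E -
    \int[m]_(x in D) (test (j + N) N p x)%:E)%E.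
  move=> mT; rewrite -integralB_EFin//; try exact: test_integrable.
  apply: eq_integral => x _; rewrite -EFinB; congr EFin.
  rewrite /test exprS natrD [(_ + _) * x]mulrDl opprD expRD; ring.
by rewrite !E// !IH.
Qed.

(** The test functions with the powers [threshold_pow c n] take values in [0, 1] on the half-line
    and converge pointwise to the indicator of the ray; as the mass is finite, dominated convergence
    applies on both sides. *)
Let ray_eq c : 0 <= c -> m1 `]c, +oo[%classic = m2 `]c, +oo[%classic.
Proof.
move=> c0.
have cvgm (m : {measure set R -> \bar R}) :
    (m setT < +oo)%E ->
    (\int[m]_(x in D) (test 0 n.+1 (threshold_pow c n) x)%:E)%E @[n --> \oo] -->
    m `]c, +oo[%classic.
  move=> mT.
  pose f n x := (test 0 n.+1 (threshold_pow c n) x)%:E.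
  pose g x := (\1_(`]c, +oo[ : set R) x : R)%:E.
  have mf n : measurable_fun D (f n).
    by apply/measurable_EFinP/measurable_funTS; exact: mtest.
  have mg : measurable_fun D g.
    by apply/measurable_EFinP/measurable_funTS; exact: measurable_indic.
  have fg : {ae m, forall x, D x -> f n x @[n --> \oo] --> g x}.
    apply: aeW => x Dx; apply: cvg_EFin; first exact: nearW.
    rewrite /f /=; under eq_fun do rewrite test0.
    apply: threshold_cvg => //.
    by move: Dx; rewrite /D/= in_itv/= andbT.
  have i1 : m.-integrable D (fun=> 1%E).
    have := test_integrable 0 0 0 mT.
    rewrite (_ : EFin \o _ = fun=> 1%E)//; apply/funext => x /=.
    by rewrite test0 expr0.
  have f1 : {ae m, forall x n, D x -> (`|f n x| <= 1)%E}.
    apply: aeW => x n Dx /=.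
    have /andP[a b] := test01 0 n.+1 (threshold_pow c n) Dx.
    by rewrite lee_fin ger0_norm.
  have [_ _] := dominated_convergence mD mf mg fg i1 f1.
  have -> : (\int[m]_(x in D) g x)%E = m `]c, +oo[%classic.
    rewrite integral_indic//; congr (m _); apply/setIidl => x /=.
    rewrite /D/= !in_itv/= !andbT => cx; exact: le_trans c0 (ltW cx).
  exact.
have := cvgm m1 fin1.
under eq_fun do rewrite test_eq.
move=> h1; have h2 := cvgm m2 fin2.
exact: (cvg_unique _ h1 h2).
Qed.

Let setT_eq : m1 setT = m2 setT.
Proof.
have := laplace_eq 0.
have E (m : {measure set R -> \bar R}) :
    (\int[m]_x (expR (- (0%:R * x)))%:E = \int[m]_x (cst 1%E x))%E.
  by apply: eq_integral => x _; rewrite mulr0n mul0r oppr0 expR0.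
by rewrite !E !integral_cst// !mul1e.
Qed.

(** Open rays form a pi-system generating the Borel sets. Rays with a negative endpoint carry the
    whole mass, which is the transform at 0. *)
Lemma laplace_unique B : measurable B -> m1 B = m2 B.
Proof.
move=> mB.
apply: (measure_unique (@RGenOInfty.G R) (fun n => `](- n%:R), +oo[%classic)) => //.
- exact: RGenOInfty.measurableE.
- move=> A1 A2 [a ->] [b ->]; exists (Num.max a b).
  rewrite eqEsubset; split => x /=; rewrite !in_itv/= !andbT gt_max.
    by case=> -> ->.
  by move=> /andP[].
- by move=> n; exists (- n%:R).
- rewrite -subTset => x _; exists (Num.truncn `|x|).+1 => //=.
  rewrite in_itv/= andbT ltrNl (le_lt_trans _ (truncnS_gt _))//.
  by rewrite -normrN ler_norm.
- move=> A [c ->]; have [c0|c0] := leP 0 c; first exact: ray_eq.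
  have ray (m : {measure set R -> \bar R}) :
      m `]-oo, 0[%classic = 0%E -> m `]c, +oo[%classic = m setT.
    move=> m0; apply/eqP; rewrite eq_le le_measure ?inE//=.
    apply: (@le_trans _ _ (m (`]c, +oo[%classic `|` `]-oo, 0[%classic))).
      rewrite le_measure ?inE//; first exact: measurableU.
      move=> x _ /=; rewrite !in_itv/= !andbT.
      by have [|x0] := ltP x 0; [right|left; exact: lt_le_trans x0].
    apply: (@le_trans _ _ (m `]c, +oo[%classic + m `]-oo, 0%R[%classic)%E).
      exact: measureU2.
    by rewrite m0 adde0.
  by rewrite !ray.
- by move=> n; apply: le_lt_trans fin1; rewrite le_measure ?inE.
Qed.

End laplace_uniqueness.

(** * Independence and expectations *)

(** The assumption on [g] says that its conditional expectation given [phi] is the constant [c]. It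
    identifies two image measures on [T'], against which [f] is then integrated. *)
Lemma integral_weighted_proportional d d' (T : measurableType d)
    (T' : measurableType d') (R : realType) (mu : {measure set T -> \bar R})
    (phi : T -> T') (g : T -> R) (c : R) (f : T' -> \bar R) :
  measurable_fun setT phi -> measurable_fun setT g -> (forall x, 0 <= g x) ->
  0 <= c ->
  (forall A, measurable A ->
    (\int[mu]_(x in phi @^-1` A) (g x)%:E = c%:E * mu (phi @^-1` A))%E) ->
  measurable_fun setT f -> (forall y, (0 <= f y)%E) ->
  (\int[mu]_x (f (phi x) * (g x)%:E) = c%:E * \int[mu]_x f (phi x))%E.
Proof.
move=> mphi mg g0 c0 gc mf f0.
have mc : measurable_fun setT (cst c : T -> R) by exact: measurable_cst.
rewrite -(ge0_integral_weighted mu mphi mg g0 mf f0).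
transitivity (\int[weighted_image mu mphi mc (fun=> c0)]_x f x)%E.
  apply: eq_measure_integral => A mA _; rewrite /= /weighted_image gc//.
  apply/esym; apply: (integral_cst mu _ c%:E).
  by rewrite -[X in measurable X]setTI; exact: mphi.
rewrite ge0_integral_weighted//.
under eq_integral do rewrite muleC /=.
by rewrite ge0_integralZl//; exact: measurableT_comp.
Qed.

Section independence_expectation.
Context d d' (R : realType) (Omega : measurableType d) (T' : measurableType d').
Variables (P : probability Omega R) (I : choiceType) (X : I -> Omega -> T').
Hypothesis mX : forall i, measurable_fun setT (X i).
Variables (f : I -> T' -> R) (e : I -> R).
Hypothesis mf : forall i, measurable_fun setT (f i).
Hypothesis f0 : forall i y, 0 <= f i y.
Hypothesis fe : forall i, (\int[P]_w (f i (X i w))%:E = (e i)%:E)%E.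

Lemma measurable_prod_comp (s : seq I) :
  measurable_fun setT (fun w => \prod_(i <- s) f i (X i w)).
Proof.
elim: s => [|i s IH].
  by under eq_fun do rewrite big_nil; exact: measurable_cst.
under eq_fun do rewrite big_cons.
by apply: measurable_funM => //; exact: measurableT_comp.
Qed.

(** The event [E] makes the induction go through: peeling off the index [i] replaces [E] by its
    intersection with an event of [X i], so the product over the remaining indices is constant on
    average over events of [X i]. With [E] the event that fixes the jump counts, this integrates the
    jumps out. *)
Lemma integral_prod_independent (s : seq I) (E : set Omega) :
  uniq s -> measurable E ->
  (forall B, (forall i, measurable (B i)) ->
    P (E `&` \bigcap_(i in [set` s]) (X i @^-1` B i)) =
    (P E * \prod_(i <- s) P (X i @^-1` B i))%E) ->
  (\int[P]_(w in E) (\prod_(i <- s) f i (X i w))%:E =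
   P E * (\prod_(i <- s) e i)%:E)%E.
Proof.
have mpre i A : measurable A -> measurable (X i @^-1` A).
  by move=> mA; rewrite -[X in measurable X]setTI; exact: mX.
have e0 i : 0 <= e i.
  by rewrite -lee_fin -fe; apply: integral_ge0 => w _; rewrite lee_fin.
elim: s E => [|i s IH] E.
  move=> _ mE _; under eq_integral do rewrite big_nil.
  by rewrite integral_cst// big_nil mul1e mule1.
move=> /=/andP[nis us] mE indep.
have split A B : (forall j, measurable (B j)) -> measurable A ->
    P (E `&` X i @^-1` A `&` \bigcap_(j in [set` s]) (X j @^-1` B j)) =
    (P E * (P (X i @^-1` A) * \prod_(j <- s) P (X j @^-1` B j)))%E.
  move=> mB mA; have /= := indep (fun j => if j == i then A else B j).
  rewrite !bigcap_seq !big_cons eqxx setIA.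
  rewrite (@eq_big_seq _ _ _ _ _ (fun j => X j @^-1` (if j == i then A else B j))
    (fun j => X j @^-1` B j)); last first.
    by move=> j js; case: eqP js => // ->; rewrite (negbTE nis).
  rewrite (@eq_big_seq _ _ _ _ _ (fun j => P (X j @^-1` (if j == i then A else B j)))
    (fun j => P (X j @^-1` B j))); last first.
    by move=> j js; case: eqP js => // ->; rewrite (negbTE nis).
  by apply=> j; case: ifP.
have step A : measurable A ->
    (\int[P]_(w in E `&` X i @^-1` A) (\prod_(j <- s) f j (X j w))%:E =
     P E * P (X i @^-1` A) * (\prod_(j <- s) e j)%:E)%E.
  move=> mA; have PE : P (E `&` X i @^-1` A) = (P E * P (X i @^-1` A))%E.
    have := split A (fun=> setT) (fun=> measurableT) mA.
    rewrite bigcap_seq big1 => [|j _]; last by rewrite preimage_setT.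
    by rewrite setIT => ->; rewrite big1 ?mule1// => j _; rewrite preimage_setT probability_setT.
  rewrite IH ?PE//; first exact: measurableI (mpre _ _ _).
  by move=> B mB; rewrite split// muleA.
pose g w := \1_E w * \prod_(j <- s) f j (X j w).
have mg : measurable_fun setT g.
  by apply: measurable_funM; [exact: measurable_indic|exact: measurable_prod_comp].
have g0 w : 0 <= g w by rewrite mulr_ge0// prodr_ge0.
have PEfin : (fine (P E))%:E = P E by rewrite fineK// fin_num_measure.
have c0 : 0 <= fine (P E) * \prod_(j <- s) e j.
  by rewrite mulr_ge0 ?fine_ge0 ?prodr_ge0.
have gc A : measurable A -> (\int[P]_(w in X i @^-1` A) (g w)%:E =
    (fine (P E) * \prod_(j <- s) e j)%:E * P (X i @^-1` A))%E.
  move=> mA; rewrite EFinM PEfin -muleA (muleC _ (P (X i @^-1` _))) muleA -step//.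
  rewrite setIC integral_mkcondr; apply: eq_integral => w _.
  by rewrite epatch_indic /g EFinM muleC.
have mfe : measurable_fun setT (fun y => (f i y)%:E) by exact/measurable_EFinP.
have := @integral_weighted_proportional _ _ _ _ _ P (X i) g _
  (fun y => (f i y)%:E) (mX i) mg g0 c0 gc mfe.
rewrite fe big_cons => h.
rewrite integral_mkcond.
transitivity (\int[P]_x ((f i (X i x))%:E * (g x)%:E))%E.
  apply: eq_integral => w _; rewrite epatch_indic big_cons /g !EFinM.
  by rewrite -muleA; congr (_ * _)%E; rewrite muleC.
rewrite h; last by move=> y; rewrite lee_fin.
by rewrite -[in RHS]PEfin -!EFinM; congr EFin; ring.
Qed.

End independence_expectation.

(** The level sets of [V] partition the space. They are indexed by [pickle]; a natural number that
    codes no value of [V] gives the empty set. *)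
Lemma eq_integral_level_sets d (T : measurableType d) (R : realType)
    (mu : {measure set T -> \bar R}) (C : countType) (V : T -> C)
    (f g : T -> \bar R) :
  (forall c, measurable (V @^-1` [set c])) ->
  measurable_fun setT f -> measurable_fun setT g ->
  (forall x, (0 <= f x)%E) -> (forall x, (0 <= g x)%E) ->
  (forall c, (\int[mu]_(x in V @^-1` [set c]) f x =
              \int[mu]_(x in V @^-1` [set c]) g x)%E) ->
  (\int[mu]_x f x = \int[mu]_x g x)%E.
Proof.
move=> mV mf mg f0 g0 fg.
pose F k := (pickle \o V) @^-1` [set k].
have FE k : (exists c, F k = V @^-1` [set c]) \/ F k = set0.
  have [[x xk]|nx] := pselect (exists x, pickle (V x) = k); [left|right].
    exists (V x); apply/seteqP; split => y; rewrite /F /= -xk.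
      exact: (pcan_inj pickleK).
    by move=> ->.
  by apply/seteqP; split => // y yk; apply: nx; exists y.
have mF k : measurable (F k) by case: (FE k) => [[c ->]|->].
have FT : setT = \bigcup_k F k by apply/seteqP; split => // x _; exists (pickle (V x)).
have tF : trivIset setT F by move=> i j _ _ [x []] <- <-.
rewrite FT !ge0_integral_bigcup//; rewrite -?FT//.
apply: eq_eseriesr => k _; case: (FE k) => [[c ->]|->]; first exact: fg.
by rewrite !integral_set0.
Qed.

(** * Pathwise solution of the equation *)

(** The upper bound comes from e^(-y) <= 1 / (1 + y) = 1 - y + y^2 / (1 + y). *)
Lemma expRN_taylor1 (R : realType) (y : R) : 0 <= y ->
  0 <= expR (- y) - 1 + y <= y ^+ 2.
Proof.
move=> y0; apply/andP; split; first by have := expR_ge1Dx (- y); lra.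
have : expR (- y) <= (1 + y)^-1.
  by rewrite expRN lef_pV2 ?posrE ?expR_gt0 ?expR_ge1Dx//; lra.
have y1 : 0 < 1 + y by lra.
have E : (1 + y)^-1 = 1 - y + y ^+ 2 * (1 + y)^-1 by field; rewrite gt_eqF.
have : y ^+ 2 * (1 + y)^-1 <= y ^+ 2.
  by rewrite ler_piMr ?sqr_ge0// invf_le1//; lra.
by move: E; lra.
Qed.

Lemma Rintegral_itv_le (R : realType) (f : R -> R) (u v B : R) : u <= v ->
  lebesgue_measure.-integrable `]u, v] (EFin \o f) ->
  (forall r, u < r <= v -> `|f r| <= B) ->
  `|\int[lebesgue_measure]_(r in `]u, v]) f r| <= B * (v - u).
Proof.
move=> uv intf fB; apply: le_trans (le_normr_Rintegral _ intf) _ => //.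
have -> : B * (v - u) = \int[lebesgue_measure]_(r in `]u, v]) B.
  rewrite Rintegral_cst//= lebesgue_measure_itv/= lte_fin.
  have [//|vu] := ltP u v.
  have -> : u = v by apply/eqP; rewrite eq_le uv vu.
  by rewrite subrr.
apply: le_Rintegral => //.
- exact: integrable_norm intf.
- apply: (@measurable_bounded_integrable _ _ _ _ (fun=> B)) => //.
  + by rewrite /= lebesgue_measure_itv/=; case: ifP => _; rewrite -?EFinB ltry.
  + exists `|B|; split => // r Br y _ /=; exact: ltW.
Qed.

(* Riemann-Stieltjes sum of exp(-k (u + n h - .)) against z on [u, u + n h]. *)
Definition exp_grid_sum (R : realType) (k : R) (z : R -> R) (u h : R) (n : nat) :=
  \sum_(i < n) expR (- (k * ((n - i.+1)%:R * h))) *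
    (z (u + i.+1%:R * h) - z (u + i%:R * h)).

Section OU_path.
Context {R : realType}.
Variables (k x0 : R) (x z : R -> R).
Hypotheses (k0 : 0 < k) (z00 : z 0 = 0).
Hypothesis z_ndecr : forall s t, 0 <= s -> s <= t -> z s <= z t.
Hypothesis x_eqn : forall t, 0 <= t ->
  lebesgue_measure.-integrable `[0, t] (EFin \o x) /\
  x t = x0 - k * \int[lebesgue_measure]_(u in `[0, t]) x u + z t.

Let x_integrable (u v : R) : 0 <= u -> u <= v ->
  lebesgue_measure.-integrable `]u, v] (EFin \o x).
Proof.
move=> u0 uv; have [+ _] := x_eqn (le_trans u0 uv).
apply: integrableS => //; apply: subset_itvr; rewrite bnd_simp.
exact: u0.
Qed.

Let x_increment (u v : R) : 0 <= u -> u <= v ->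
  x v - x u = - (k * \int[lebesgue_measure]_(r in `]u, v]) x r) + (z v - z u).
Proof.
move=> u0 uv; have [iv ->] := x_eqn (le_trans u0 uv).
have [_ ->] := x_eqn u0.
by rewrite -(@Rintegral_itvB _ x (BLeft 0) (BRight v) u)//; ring.
Qed.

(** The equation itself bounds [x]: the integral of |x| over [0, T] is finite and [z] is at most
    [z T]. *)
Let x_bounded (T : R) : 0 <= T ->
  exists2 M : R, 0 <= M & forall r, 0 <= r <= T -> `|x r| <= M.
Proof.
move=> T0; have [iT _] := x_eqn T0.
exists (`|x0| + k * \int[lebesgue_measure]_(u in `[0, T]) `|x u| + z T).
  rewrite !addr_ge0//; first by rewrite mulr_ge0 ?(ltW k0)// Rintegral_ge0.
  by rewrite -z00 z_ndecr.
move=> r /andP[r0 rT]; have [ir ->] := x_eqn r0.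
apply: (le_trans (ler_normD _ _)); apply: lerD; last first.
  by rewrite ger0_norm ?z_ndecr// -z00 z_ndecr.
apply: (le_trans (ler_normB _ _)); apply: lerD => //.
rewrite normrM (gtr0_norm k0) ler_pM2l//.
apply: le_trans (le_normr_Rintegral _ ir) _ => //.
have inT := integrable_norm iT.
rewrite -subr_ge0 (@Rintegral_itvB _ _ (BLeft 0) (BRight T) r)//.
by rewrite Rintegral_ge0.
Qed.

(** The driving path may jump, so a step of length h is not accurate to order h^2; but the error is
    at most C h times (h plus the increment of [z]). The second factor telescopes along a grid, so
    the accumulated error is still of order h. *)
Lemma OU_step_error (T : R) : 0 <= T ->
  exists2 C : R, 0 <= C & forall u v, 0 <= u -> u <= v -> v <= T ->
    `|x v - expR (- (k * (v - u))) * x u - (z v - z u)| <=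
    C * (v - u) * (v - u + (z v - z u)).
Proof.
move=> T0; have [M M0 xM] := x_bounded T0.
(* The term 2 k^2 M collects two contributions of order h^2, from the drift and from the Taylor
   remainder of the exponential; the remaining k pays for h times the increment of [z]. *)
exists (k * (2 * k * M + 1)).
  by rewrite mulr_ge0 ?addr_ge0 ?mulr_ge0 ?(ltW k0).
move=> u v u0 uv vT.
have h0 : 0 <= v - u by rewrite subr_ge0.
set h := v - u in h0 *; set dz := z v - z u.
have dz0 : 0 <= dz by rewrite subr_ge0 z_ndecr.
have xr r : u < r <= v -> `|x r - x u| <= k * M * h + dz.
  move=> /andP[ur rv]; rewrite (x_increment u0 (ltW ur)).
  apply: (le_trans (ler_normD _ _)); apply: lerD; last first.
    rewrite ger0_norm ?subr_ge0; last exact: z_ndecr (ltW ur).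
    by rewrite lerD2r z_ndecr// (le_trans u0)// ltW.
  rewrite normrN normrM (gtr0_norm k0) -mulrA ler_pM2l//.
  apply: (@le_trans _ _ (M * (r - u))); last by rewrite ler_wpM2l// lerD2r.
  apply: (Rintegral_itv_le (ltW ur)); first exact: x_integrable (ltW ur).
  move=> q /andP[uq qr]; apply: xM.
  by rewrite (le_trans u0 (ltW uq)) (le_trans qr) ?(le_trans rv).
have ic : lebesgue_measure.-integrable `]u, v] (EFin \o (fun=> x u)).
  apply: measurable_bounded_integrable => //.
  - by rewrite /= lebesgue_measure_itv/=; case: ifP => _; rewrite -?EFinB ltry.
  - exists `|x u|; split => // r Br y _ /=; exact: ltW.
have ix := x_integrable u0 uv.
have intE : \int[lebesgue_measure]_(r in `]u, v]) (x r - x u) =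
    \int[lebesgue_measure]_(r in `]u, v]) x r - h * x u.
  rewrite RintegralB//; congr (_ - _).
  rewrite Rintegral_cst//= lebesgue_measure_itv/= lte_fin mulrC.
  case: ltP => //= vu; rewrite /h; have -> : v = u by apply/eqP; rewrite eq_le uv vu.
  by rewrite subrr.
have ib : `|\int[lebesgue_measure]_(r in `]u, v]) (x r - x u)| <=
    (k * M * h + dz) * h.
  apply: Rintegral_itv_le => //.
  exact: (integrableB _ ix ic).
(* Freezing [x] at its left value in the integral leaves the fluctuation of [x] over the step and
   the second-order remainder of e^(-kh). *)
have -> : x v - expR (- (k * h)) * x u - dz =
    - (k * \int[lebesgue_measure]_(r in `]u, v]) (x r - x u)) -
    (expR (- (k * h)) - 1 + k * h) * x u.
  have := x_increment u0 uv; rewrite intE -/dz => E.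
  have -> : x v = x u + (x v - x u) by ring.
  by rewrite E; ring.
apply: (le_trans (ler_normB _ _)).
rewrite normrN !normrM (gtr0_norm k0).
have /expRN_taylor1/andP[e0 e1] : 0 <= k * h by rewrite mulr_ge0 ?(ltW k0).
rewrite (ger0_norm e0).
have xu : `|x u| <= M by apply: xM; rewrite u0 (le_trans uv).
have t1 : k * `|\int[lebesgue_measure]_(r in `]u, v]) (x r - x u)| <=
    k * ((k * M * h + dz) * h) by rewrite ler_pM2l.
have t2 : (expR (- (k * h)) - 1 + k * h) * `|x u| <= (k * h) ^+ 2 * M.
  exact: ler_pM.
apply: (le_trans (lerD t1 t2)).
rewrite -subr_ge0.
have -> : k * (2 * k * M + 1) * h * (h + dz) -
    (k * ((k * M * h + dz) * h) + (k * h) ^+ 2 * M) =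
    k * h * h + 2 * k * k * M * h * dz by ring.
by rewrite addr_ge0 ?mulr_ge0 ?(ltW k0).
Qed.

Local Notation grid_sum := (exp_grid_sum k z).

(** Each step multiplies the previous error by e^(-kh) <= 1 and adds the local one, so the local
    bounds simply add up. *)
Let grid_sum_error (T C u h : R) n : 0 <= u -> 0 <= h -> 0 <= C ->
  (forall u v, 0 <= u -> u <= v -> v <= T ->
    `|x v - expR (- (k * (v - u))) * x u - (z v - z u)| <=
    C * (v - u) * (v - u + (z v - z u))) ->
  u + n%:R * h <= T ->
  `|x (u + n%:R * h) - expR (- (k * (n%:R * h))) * x u - grid_sum u h n| <=
  C * h * (n%:R * h + (z (u + n%:R * h) - z u)).
Proof.
move=> u0 h0 C0 stepE; elim: n => [_|n IH nT].
  rewrite /exp_grid_sum big_ord0 mulr0n !mul0r addr0 mulr0 oppr0 expR0 mul1r !subrr.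
  by rewrite !addr0 normr0 mulr0.
set v := u + n%:R * h in IH *; set w := u + n.+1%:R * h in nT *.
have wv : w - v = h by rewrite /w /v -natr1; ring.
have vw : v <= w by rewrite -subr_ge0 wv.
have v0 : 0 <= v by rewrite addr_ge0 ?mulr_ge0.
have := IH (le_trans vw nT); have := stepE v w v0 vw nT.
rewrite wv.
have -> : grid_sum u h n.+1 =
    expR (- (k * h)) * grid_sum u h n + (z w - z v).
  rewrite /exp_grid_sum big_ord_recr/= subnn mulr0n mul0r mulr0 oppr0 expR0 mul1r.
  congr (_ + _); rewrite mulr_sumr; apply: eq_bigr => i _.
  rewrite [RHS]mulrA -expRD; congr (expR _ * _).
  have -> : (n.+1 - i.+1 = (n - i.+1).+1)%N by rewrite subSS subnSK.
  by rewrite -natr1; ring.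
have -> : expR (- (k * (n.+1%:R * h))) =
    expR (- (k * h)) * expR (- (k * (n%:R * h))).
  by rewrite -expRD; congr expR; rewrite -natr1; ring.
set q := expR (- (k * h)); set S := grid_sum u h n; set y := _ * x u.
move=> A B.
have -> : x w - q * expR (- (k * (n%:R * h))) * x u - (q * S + (z w - z v)) =
    (x w - q * x v - (z w - z v)) + q * (x v - y - S) by rewrite /y; ring.
apply: (le_trans (ler_normD _ _)).
rewrite normrM (ger0_norm (expR_ge0 _)).
have q1 : q <= 1 by rewrite -[leRHS](@expR0 R) ler_expR oppr_le0 mulr_ge0 ?(ltW k0).
have : q * `|x v - y - S| <= `|x v - y - S| by rewrite ler_piMl.
move=> D; apply: (le_trans (lerD A (le_trans D B))).
rewrite -natr1 le_eqVlt; apply/orP; left; apply/eqP; ring.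
Qed.

Lemma OU_grid_sum_cvg (u t : R) : 0 <= u -> 0 <= t ->
  grid_sum u (t / n.+1%:R) n.+1 @[n --> \oo] --> x (u + t) - expR (- (k * t)) * x u.
Proof.
move=> u0 t0; have ut0 : 0 <= u + t by rewrite addr_ge0.
have [C C0 stepE] := OU_step_error ut0.
have tE n : n.+1%:R * (t / n.+1%:R) = t :> R.
  by rewrite mulrCA divff ?mulr1// pnatr_eq0.
set l := _ - _; pose K := C * t * (t + (z (u + t) - z u)).
have bound n : `|l - grid_sum u (t / n.+1%:R) n.+1| <= K / n.+1%:R.
  have := @grid_sum_error (u + t) C u (t / n.+1%:R) n.+1 u0.
  rewrite tE => /(_ _ C0 stepE (lexx _)) H.
  apply: le_trans (H _) _; first by rewrite divr_ge0.
  by rewrite /K le_eqVlt; apply/orP; left; apply/eqP; ring.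
apply/cvgrPdist_le => e e0.
have : K * n.+1%:R^-1 @[n --> \oo] --> K * 0.
  by apply: cvgMr; exact: cvg_harmonic.
rewrite mulr0 => /cvgrPdist_le/(_ _ e0); apply: filterS => n.
rewrite sub0r normrN => h; apply: le_trans (bound n) (le_trans (ler_norm _) h).
Qed.

End OU_path.

(** The left-endpoint sums approximate the integral over [0, t] of theta e^(-ku) / (beta + theta
    e^(-ku)), whose antiderivative is -ln (beta + theta e^(-ku)) / k. With L the difference of
    logarithms and h the mesh, comparing increments of the logarithm with the summands squeezes the
    sum between (L / k) e^(-kh) and (L / k) e^(kh). *)
Lemma log_riemann_sum (R : realType) (k beta theta t : R) :
  0 < k -> 0 < beta -> 0 <= theta -> 0 <= t ->
  let h n := t / n.+1%:R in
  \sum_(j < n.+1) h n * (theta * expR (- (k * (j%:R * h n))) /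
    (beta + theta * expR (- (k * (j%:R * h n))))) @[n --> \oo] -->
  (ln (beta + theta) - ln (beta + theta * expR (- (k * t)))) / k.
Proof.
move=> k0 b0 th0 t0 h; set L := ln _ - ln _.
pose g h (j : nat) := theta * expR (- (k * (j%:R * h))).
have g0 r j : 0 <= g r j by rewrite mulr_ge0// expR_ge0.
have c0 r j : 0 < beta + g r j by rewrite ltr_wpDr.
have lnlb (y : R) : 0 < y -> ln y <= y - 1.
  by move=> y0; have := @le_ln1Dx R (y - 1); rewrite [1 + _]addrC subrK; apply; lra.
pose S r n := \sum_(j < n) g r j / (beta + g r j).
have gS r j : g r j.+1 = g r j * expR (- (k * r)).
  by rewrite /g -mulrA -expRD; congr (_ * expR _); rewrite -natr1; ring.
have S0 r n : 0 <= S r n by apply: sumr_ge0 => j _; rewrite divr_ge0// ltW.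
(* Applying ln y <= y - 1 to the ratio of two consecutive values beta + g, and to its inverse,
   bounds each increment of the logarithm on both sides. The upper bound produces the right-endpoint
   sum, which is [S r n] without its first term and with one more at the end. *)
have tele r n : 0 <= r ->
    S r n * (1 - expR (- (k * r))) <= ln (beta + g r 0) - ln (beta + g r n) /\
    ln (beta + g r 0) - ln (beta + g r n) <=
      (S r n - g r 0 / (beta + g r 0) + g r n / (beta + g r n)) *
      (expR (k * r) - 1).
  move=> r0; elim: n => [|n [IH1 IH2]].
    rewrite /S big_ord0 !subrr mul0r sub0r addNr mul0r; split => //.
  have e : expR (k * r) * expR (- (k * r)) = 1 by rewrite -expRD subrr expR0.
  have SS : S r n.+1 = S r n + g r n / (beta + g r n) by rewrite /S big_ord_recr.
  have E : ln (beta + g r 0) - ln (beta + g r n.+1) =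
     ln (beta + g r 0) - ln (beta + g r n) +
     (ln (beta + g r n) - ln (beta + g r n.+1)) by ring.
  rewrite SS E; split.
    rewrite mulrDl lerD// -lerN2 opprB -ln_div ?posrE//.
    apply: (le_trans (lnlb _ _)); first by rewrite divr_gt0.
    rewrite le_eqVlt; apply/orP; left; apply/eqP; rewrite gS.
    by field; rewrite gt_eqF.
  have -> : S r n + g r n / (beta + g r n) - g r 0 / (beta + g r 0) +
     g r n.+1 / (beta + g r n.+1) =
     (S r n - g r 0 / (beta + g r 0) + g r n / (beta + g r n)) +
     g r n.+1 / (beta + g r n.+1) by ring.
  rewrite mulrDl lerD// -ln_div ?posrE//.
  apply: (le_trans (lnlb _ _)); first by rewrite divr_gt0.
  rewrite le_eqVlt; apply/orP; left; apply/eqP.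
  have -> : g r n = g r n.+1 * expR (k * r) by rewrite gS -mulrA [_ * expR (k * r)]mulrC e mulr1.
  by field; rewrite gt_eqF.
have L0 n : ln (beta + g (h n) 0) - ln (beta + g (h n) n.+1) = L.
  rewrite /g mulr0n mul0r mulr0 oppr0 expR0 mulr1 /L; congr (_ - ln (_ + _ * expR (- (_ * _)))).
  by rewrite /h mulrCA divff ?mulr1// pnatr_eq0.
have h0 n : 0 <= h n by rewrite divr_ge0.
have sumE n : \sum_(j < n.+1) h n * (theta * expR (- (k * (j%:R * h n))) /
    (beta + theta * expR (- (k * (j%:R * h n))))) = h n * S (h n) n.+1.
  by rewrite /S mulr_sumr.
under eq_fun do rewrite sumE.
have upper n : h n * S (h n) n.+1 <= L / k * expR (k * h n).
  have [A _] := tele (h n) n.+1 (h0 n); rewrite L0 in A.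
  have B : expR (- (k * h n)) * (k * h n) <= 1 - expR (- (k * h n)).
    have E : 1 = expR (- (k * h n)) * expR (k * h n) by rewrite -expRD addNr expR0.
    have -> : 1 - expR (- (k * h n)) = expR (- (k * h n)) * (expR (k * h n) - 1).
      by rewrite mulrBr mulr1 -E.
    rewrite ler_wpM2l ?expR_ge0//.
    by have := expR_ge1Dx (k * h n); lra.
  have D := le_trans (ler_wpM2l (S0 (h n) n.+1) B) A.
  rewrite -(ler_pM2l k0) -(ler_pM2r (expR_gt0 (- (k * h n)))).
  have -> : k * (L / k * expR (k * h n)) * expR (- (k * h n)) = L.
    rewrite -!mulrA -expRD subrr expR0 mulr1; field; exact: lt0r_neq0.
  by apply: le_trans D; rewrite le_eqVlt; apply/orP; left; apply/eqP; ring.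
have lower n : L / k * expR (- (k * h n)) <= h n * S (h n) n.+1.
  have [_ A] := tele (h n) n.+1 (h0 n); rewrite L0 in A.
  (* As q / (beta + q) increases with q and g decreases along the grid, the right-endpoint sum is at
     most the left-endpoint one. *)
  have gd : g (h n) n.+1 / (beta + g (h n) n.+1) <= g (h n) 0 / (beta + g (h n) 0).
    have gg : g (h n) n.+1 <= g (h n) 0.
      rewrite /g; apply: ler_wpM2l => //; rewrite ler_expR lerN2 mulr0n mul0r.
      by rewrite mulr0 mulr_ge0 ?(ltW k0)// mulr_ge0.
    move: (g0 (h n) n.+1) (g0 (h n) 0) gg.
    move: (g _ n.+1) (g _ 0) => p q p0 q0 pq.
    have bp : 0 < beta + p by rewrite ltr_wpDr.
    have bq : 0 < beta + q by rewrite ltr_wpDr.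
    rewrite ler_pdivrMr// mulrAC ler_pdivlMr//.
    have : p * beta <= q * beta by rewrite ler_wpM2r// ltW.
    by move=> ?; lra.
  have B : expR (k * h n) - 1 <= expR (k * h n) * (k * h n).
    have E : 1 = expR (k * h n) * expR (- (k * h n)) by rewrite -expRD subrr expR0.
    have -> : expR (k * h n) - 1 = expR (k * h n) * (1 - expR (- (k * h n))).
      by rewrite mulrBr mulr1 -E.
    rewrite ler_wpM2l ?expR_ge0//.
    by have := expR_ge1Dx (- (k * h n)); lra.
  have D : L <= S (h n) n.+1 * (expR (k * h n) * (k * h n)).
    apply: (le_trans A); apply: ler_pM => //.
    - have : g (h n) 0 / (beta + g (h n) 0) <= S (h n) n.+1.
        rewrite /S big_ord_recl lerDl; apply: sumr_ge0 => j _.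
        by rewrite divr_ge0// ltW.
      have : 0 <= g (h n) n.+1 / (beta + g (h n) n.+1) by rewrite divr_ge0// ltW.
      by lra.
    - have := expR_ge1Dx (k * h n).
      have : 0 <= k * h n by rewrite mulr_ge0// ltW.
      by lra.
    - by lra.
  rewrite -(ler_pM2l k0) -(ler_pM2r (expR_gt0 (k * h n))).
  have -> : k * (L / k * expR (- (k * h n))) * expR (k * h n) = L.
    rewrite -!mulrA -expRD addNr expR0 mulr1; field; exact: lt0r_neq0.
  by apply: (le_trans D); rewrite le_eqVlt; apply/orP; left; apply/eqP; ring.
have hcvg (c : R) : L / k * expR (c * h n) @[n --> \oo] --> L / k.
  rewrite -[X in _ --> X]mulr1 -(@expR0 R); apply: cvgMr.
  apply: continuous_cvg; first exact: continuous_expR.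
  rewrite -(mulr0 (c * t)).
  under eq_fun do rewrite /h mulrA.
  by apply: cvgMr; exact: cvg_harmonic.
apply: squeeze_cvgr (hcvg (- k)) (hcvg k).
by apply: nearW => n; rewrite upper mulNr lower.
Qed.

(** * Exponential, Poisson and Erlang laws *)

Lemma nneseries_EFin_cvg (R : realType) (u : nat -> R) (l : R) :
  series u @ \oo --> l -> (\sum_(n <oo) (u n)%:E = l%:E)%E.
Proof.
move=> ul; apply/cvg_lim => //.
under eq_fun do rewrite sumEFin.
by apply: cvg_EFin; [exact: nearW|exact: ul].
Qed.

(** Exponential tilting: e^(-cx) times the density of rate beta is beta / (beta + c) times the
    density of rate beta + c, which integrates to 1. *)
Lemma integral_exponential_pdf_decay (R : realType) (beta c : R) :
  0 < beta -> 0 <= c ->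
  (\int[lebesgue_measure]_x ((expR (- (c * x)))%:E * (exponential_pdf beta x)%:E) =
   (beta / (beta + c))%:E)%E.
Proof.
move=> b0 c0; have bc0 : 0 < beta + c by rewrite ltr_wpDr.
transitivity (\int[lebesgue_measure]_x
    ((beta / (beta + c))%:E * (exponential_pdf (beta + c) x)%:E))%E.
  apply: eq_integral => x _; rewrite -!EFinM; congr EFin.
  have [x0|x0] := ltP x 0; first by rewrite !lt0_exponential_pdf// !mulr0.
  rewrite !exponential_pdfE//.
  rewrite mulrCA -expRD [RHS]mulrA divfK ?gt_eqF//; congr (_ * expR _); ring.
rewrite ge0_integralZl_EFin//.
- by rewrite integral_exponential_pdf// mule1.
- by move=> x _; rewrite lee_fin exponential_pdf_ge0// ltW.
- by apply/measurable_EFinP; exact: measurable_exponential_pdf.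
- by rewrite divr_ge0// ltW.
Qed.

Lemma exponential_laplace d (R : realType) (Omega : measurableType d)
    (P : probability Omega R) (J : {RV P >-> R}) (beta c : R) :
  0 < beta -> 0 <= c ->
  (forall B : set R, measurable B ->
    distribution P J B = exponential_prob beta B) ->
  (\int[P]_w (expR (- (c * J w)))%:E = (beta / (beta + c))%:E)%E.
Proof.
move=> b0 c0 lawJ; rewrite -integral_exponential_pdf_decay//.
have md : measurable_fun setT (fun x : R => (expR (- (c * x)))%:E).
  by apply/measurable_EFinP; exact: measurable_decay.
have mid : measurable_fun setT (id : measurableTypeR R -> R) by exact: measurable_id.
have mpdf : measurable_fun setT (exponential_pdf beta : measurableTypeR R -> R).
  exact: measurable_exponential_pdf.
have pdf0 x : 0 <= exponential_pdf beta x by rewrite exponential_pdf_ge0// ltW.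
rewrite -(@ge0_integral_distribution _ _ _ _ _ P J _ md); last first.
  by move=> x; rewrite lee_fin expR_ge0.
rewrite -(ge0_integral_weighted lebesgue_measure mid mpdf pdf0 md); last first.
  by move=> x; rewrite lee_fin expR_ge0.
by apply: eq_measure_integral => A mA _; exact: lawJ.
Qed.

Lemma poisson_pgf d (R : realType) (Omega : measurableType d)
    (P : probability Omega R) (V : Omega -> nat) (mu r : R) :
  measurable_fun setT V -> 0 < mu -> 0 <= r ->
  (forall n, P [set w | V w = n] = (poisson_pmf mu n)%:E) ->
  (\int[P]_w (r ^+ V w)%:E = (expR (mu * (r - 1)))%:E)%E.
Proof.
move=> mV mu0 r0 lawV.
pose F n := V @^-1` [set n].
have mF n : measurable (F n) by rewrite -[F n]setTI; exact: mV.
have FT : setT = \bigcup_n F n by apply/seteqP; split => // w _; exists (V w).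
have tF : trivIset setT F by move=> i j _ _ [w []] <- <-.
have mr : measurable_fun setT (fun w => r ^+ V w).
  by apply: (measurableT_comp (f := fun n : nat => r ^+ n)).
rewrite FT ge0_integral_bigcup//; last 2 first.
- by rewrite -FT; exact/measurable_EFinP.
- by move=> w _; rewrite lee_fin exprn_ge0.
have termE n : (\int[P]_(w in F n) (r ^+ V w)%:E)%E =
    (expR (- mu) * exp_coeff (mu * r) n)%:E.
  transitivity (\int[P]_(w in F n) (cst (r ^+ n)%:E w))%E.
    by apply: eq_integral => w /set_mem <-.
  transitivity ((r ^+ n)%:E * P [set w | V w = n])%E; first exact: integral_cst.
  rewrite lawV -EFinM; congr EFin.
  by rewrite /poisson_pmf mu0 /exp_coeff/= exprMn; ring.
under eq_eseriesr do rewrite termE.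
apply: nneseries_EFin_cvg.
have -> : expR (mu * (r - 1)) = expR (- mu) * expR (mu * r).
  by rewrite -expRD; congr expR; ring.
have -> : series (fun n => expR (- mu) * exp_coeff (mu * r) n) =
    fun n => expR (- mu) * series (exp_coeff (mu * r)) n.
  by apply/funext => n; rewrite /series/= mulr_sumr.
by apply: cvgMr; exact: is_cvg_series_exp_coeff.
Qed.

Lemma is_derive1_mul (R : realType) (f g : R -> R) (x a b : R) :
  is_derive x 1 f a -> is_derive x 1 g b ->
  is_derive x 1 (fun y => f y * g y) (a * g x + f x * b).
Proof.
move=> fa gb; apply: (is_derive_eq (is_deriveM fa gb)).
by rewrite /GRing.scale/=; ring.
Qed.

Lemma is_derive1_pow (R : realType) (n : nat) (x : R) :
  is_derive x 1 (fun y : R => y ^+ n) (n%:R * x ^+ n.-1).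
Proof.
elim: n => [|n IH].
  by rewrite mul0r; under eq_fun do rewrite expr0; exact: is_derive_cst.
under eq_fun do rewrite exprS.
apply: (is_derive_eq (is_derive1_mul (is_derive_id x 1) IH)).
case: n {IH} => [|n]; first by rewrite mul0r mulr0 addr0.
by rewrite /= exprS -[n.+2%:R]natr1; ring.
Qed.

Lemma is_derive1_expRN (R : realType) (b x : R) :
  is_derive x 1 (fun y : R => expR (- (b * y))) (- b * expR (- (b * x))).
Proof.
apply: is_derive_eq => //.
by rewrite -mulrC; congr (_ * _); rewrite /GRing.scale/= mulr1.
Qed.

Section erlang.
Context {R : realType}.
Implicit Types (b x : R) (j : nat).

Let erlang_term b j x := (b * x) ^+ j / j`!%:R * expR (- (b * x)).

Let erlang_term_derive b j x : is_derive x 1 (erlang_term b j)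
  (if j is i.+1 then b * (erlang_term b i x - erlang_term b j x)
   else - (b * erlang_term b j x)).
Proof.
have -> : erlang_term b j = fun y => b ^+ j / j`!%:R * (y ^+ j * expR (- (b * y))).
  by apply/funext => y; rewrite /erlang_term exprMn; ring.
have d := is_derive1_mul (is_derive1_pow j x) (is_derive1_expRN b x).
apply: (is_derive_eq (is_derive1_mul (is_derive_cst (b ^+ j / j`!%:R) x 1) d)).
rewrite mul0r add0r /cst.
case: j {d} => [|j].
  by rewrite /erlang_term expr0 fact0 /=; ring.
rewrite /erlang_term !exprMn !exprS factS natrM -pred_Sn.
by field; rewrite nat1r !pnatr_eq0 -lt0n fact_gt0.
Qed.

(** For x >= 0, [- F b j x] is the probability that a Poisson variable of mean b x is at most j, so
    1 + F is the Erlang distribution function of shape j + 1. Its derivative telescopes to the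
    density. *)
Let F b j x := - \sum_(i < j.+1) erlang_term b i x.

Let F_derive b j x : is_derive x 1 (F b j) (b * erlang_term b j x).
Proof.
elim: j => [|j IH].
  have -> : F b 0 = fun y => - erlang_term b 0 y.
    by apply/funext => y; rewrite /F big_ord1.
  by apply: (is_derive_eq (is_deriveN (erlang_term_derive b 0 x))); rewrite opprK.
have -> : F b j.+1 = fun y => F b j y - erlang_term b j.+1 y.
  by apply/funext => y; rewrite /F big_ord_recr opprD.
apply: (is_derive_eq (is_deriveB IH (erlang_term_derive b j.+1 x))).
by ring.
Qed.

Let erlang_term_ge0 b j x : 0 < b -> 0 <= x -> 0 <= erlang_term b j x.
Proof.
by move=> b0 x0; rewrite !mulr_ge0 ?expR_ge0 ?exprn_ge0 ?mulr_ge0// ltW.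
Qed.

(** With y = b x, the bound e^y >= y^(j+1) / (j+1)! makes the term at most (j + 1) / y. *)
Let erlang_term_cvg0 b j : 0 < b -> erlang_term b j x @[x --> +oo] --> 0.
Proof.
move=> b0; apply/cvgrPdist_le => e e0; near=> x.
have x0 : 0 < x by near: x; exact: nbhs_pinfty_gt.
have xe : j.+1%:R / (b * e) <= x by near: x; apply: nbhs_pinfty_ge; exact: num_real.
have y0 : 0 < b * x by rewrite mulr_gt0.
rewrite sub0r normrN ger0_norm ?erlang_term_ge0 ?(ltW x0)//.
apply: (@le_trans _ _ (j.+1%:R / (b * x))); last first.
  by rewrite ler_pdivrMr// mulrA [e * b]mulrC -ler_pdivrMl ?mulr_gt0// mulrC.
rewrite /erlang_term; move: (b * x) y0 => y y0.
have := @expR_ge1Dxn R y j (ltW y0).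
rewrite expRN ler_pdivrMr ?expR_gt0// => H.
have jf0 : 0 < (j.+1)`!%:R :> R by rewrite ltr0n fact_gt0.
have -> : y ^+ j / j`!%:R = j.+1%:R / y * (y ^+ j.+1 / (j.+1)`!%:R).
  rewrite exprS factS natrM; field.
  by rewrite nat1r !pnatr_eq0 -lt0n fact_gt0 (gt_eqF y0).
by rewrite ler_wpM2l ?divr_ge0 ?(ltW y0)//; lra.
Unshelve. all: by end_near. Qed.

Lemma integral_erlang_pdf b j : 0 < b ->
  (\int[lebesgue_measure]_x (erlang_pdf j.+1 b x)%:E = 1)%E.
Proof.
move=> b0; have cE : continuous (fun x => b * erlang_term b j x).
  move=> x; apply: differentiable_continuous; apply/derivable1_diffP.
  by have [] := is_derive1_mul (is_derive_cst b x 1) (erlang_term_derive b j x).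
have cF : continuous (F b j).
  move=> x; apply: differentiable_continuous; apply/derivable1_diffP.
  by have [] := F_derive b j x.
transitivity (\int[lebesgue_measure]_(x in `[0%R, +oo[) (b * erlang_term b j x)%:E)%E.
  (* The endpoint is dropped because [erlang_pdf] vanishes at 0, whereas for j = 0 the smooth
     expression equals b there. *)
  rewrite -integral_itv_obnd_cbnd; last first.
    by apply/measurable_EFinP/measurable_funTS; exact: continuous_measurable_fun.
  rewrite [RHS]integral_mkcond; apply: eq_integral => x _.
  rewrite /erlang_pdf patchE; case: ltP => x0; last first.
    rewrite memNset//= in_itv/= andbT; apply/negP; by rewrite -leNgt.
  rewrite mem_set/=; last by rewrite in_itv/= x0.
  by congr EFin; rewrite /erlang_term; ring.
rewrite (@ge0_continuous_FTC2y _ _ (F b j) 0 0).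
- have -> : F b j 0 = -1.
    rewrite /F big_ord_recl big1 => [|i _]; last first.
      by rewrite /erlang_term mulr0 expr0n/= !mul0r.
    by rewrite /erlang_term mulr0 oppr0 expR0 expr0 fact0 divr1 mulr1 addr0.
  by rewrite -EFinB sub0r opprK.
- by move=> x x0; rewrite mulr_ge0 ?(ltW b0)// erlang_term_ge0.
- exact: continuous_subspaceT.
- rewrite -oppr0; apply: cvgN; elim: j.+1 => [|n IH].
    by under eq_fun do rewrite big_ord0; exact: cvg_cst.
  under eq_fun do rewrite big_ord_recr/=.
  have : \sum_(i < n) erlang_term b i x + erlang_term b n x @[x --> +oo] --> 0 + 0.
    by apply: cvgD; [exact: IH|exact: erlang_term_cvg0].
  by rewrite addr0.
- by move=> x _; have [] := F_derive b j x.
- exact/cvg_at_right_filter/cF.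
- by move=> x _; rewrite derive1E; exact: derive_val.
Qed.

Lemma measurable_erlang_pdf j b : measurable_fun setT (erlang_pdf j b).
Proof.
rewrite /erlang_pdf; apply: measurable_fun_if => //.
- by apply: measurable_fun_ltr.
- apply: measurable_funTS; apply: measurable_funM; last exact: measurable_decay.
  apply: measurable_funM => //; apply: measurable_funX; exact: measurable_funM.
Qed.

Lemma erlang_pdf_ge0 j b x : 0 < b -> 0 <= erlang_pdf j b x.
Proof.
move=> b0; rewrite /erlang_pdf; case: ltP => // x0.
by rewrite !mulr_ge0 ?expR_ge0 ?invr_ge0 ?exprn_ge0 ?mulr_ge0// ltW.
Qed.

Lemma erlang_laplace j b c : 0 < b -> 0 <= c ->
  (\int[lebesgue_measure]_x ((expR (- (c * x)))%:E * (erlang_pdf j.+1 b x)%:E) =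
   ((b / (b + c)) ^+ j.+1)%:E)%E.
Proof.
move=> b0 c0; have bc0 : 0 < b + c by rewrite ltr_wpDr.
transitivity (\int[lebesgue_measure]_x
    (((b / (b + c)) ^+ j.+1)%:E * (erlang_pdf j.+1 (b + c) x)%:E))%E.
  apply: eq_integral => x _; rewrite -!EFinM; congr EFin.
  rewrite /erlang_pdf; case: ltP => x0; last by rewrite !mulr0.
  rewrite -pred_Sn mulrCA -expRD [RHS]mulrA; congr (_ * expR _); last by ring.
  rewrite expr_div_n !exprMn !exprS.
  by field; rewrite expf_neq0 ?gt_eqF//= pnatr_eq0 -lt0n fact_gt0.
rewrite ge0_integralZl_EFin//.
- by rewrite integral_erlang_pdf// mule1.
- by move=> x _; rewrite lee_fin erlang_pdf_ge0.
- by apply/measurable_EFinP; exact: measurable_erlang_pdf.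
- by rewrite exprn_ge0// divr_ge0// ltW.
Qed.

End erlang.

(** * The mixture g_a *)

Lemma cvg0_ratio (R : realType) (u : nat -> R) (q : R) (N : nat) :
  (forall n, 0 <= u n) -> 0 <= q < 1 ->
  (forall n, (N <= n)%N -> u n.+1 <= q * u n) -> u @ \oo --> 0.
Proof.
move=> u0 /andP[q0 q1] uq; rewrite -(cvg_shiftn N) /=.
have le n : u (n + N)%N <= u N * q ^+ n.
  elim: n => [|n IH]; first by rewrite add0n expr0 mulr1.
  rewrite addSn; apply: (le_trans (uq _ (leq_addl _ _))).
  by rewrite exprS mulrCA ler_wpM2l.
apply: (@squeeze_cvgr _ _ _ _ (fun=> 0) (fun n => u N * q ^+ n)).
- by apply: nearW => n; rewrite u0 le.
- exact: cvg_cst.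
- by apply: (@cvg_geometric R (u N) q); rewrite ger0_norm.
Qed.

Section negative_binomial_series.
Context {R : realType}.
Implicit Types x y : R.
Variable alpha : R.
Hypothesis alpha0 : 0 < alpha.
Local Notation c := (rising_binomial alpha).

Lemma rising_binomial_ge0 n : 0 <= c n.
Proof.
rewrite /rising_binomial divr_ge0//; apply: prodr_ge0 => i _.
by rewrite addr_ge0// ltW.
Qed.

Let recurrence n : n.+1%:R * c n.+1 = (alpha + n%:R) * c n.
Proof.
rewrite /rising_binomial big_ord_recr/= factS natrM; field.
by rewrite nat1r !pnatr_eq0 -lt0n fact_gt0.
Qed.

Let partial_sum n x := \sum_(j < n) c j * x ^+ j.

Let partial_sum_derive n x : is_derive x 1 (partial_sum n)
  (\sum_(j < n) c j * (j%:R * x ^+ j.-1)).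
Proof.
elim: n => [|n IH].
  rewrite big_ord0 (_ : partial_sum 0 = cst 0); first exact: is_derive_cst.
  by apply/funext => y; rewrite /partial_sum big_ord0.
rewrite big_ord_recr/= (_ : partial_sum n.+1 = fun y => partial_sum n y + c n * y ^+ n).
  apply: is_deriveD.
  apply: (is_derive_eq (is_derive1_mul (is_derive_cst (c n) x 1) (is_derive1_pow n x))).
  by rewrite mul0r add0r.
by apply/funext => y; rewrite /partial_sum big_ord_recr.
Qed.

(** The function (1 - x)^(-alpha) solves (1 - x) f' = alpha f; a partial sum of its series violates
    this equation by a single term. *)
Let derive_identity n x :
  (1 - x) * (\sum_(j < n) c j * (j%:R * x ^+ j.-1)) - alpha * partial_sum n x =
  - (n%:R * c n * x ^+ n.-1).
Proof.
elim: n => [|n IH]; first by rewrite /partial_sum !big_ord0; ring.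
rewrite /partial_sum !big_ord_recr/= recurrence -/(partial_sum n x).
have E : n%:R * x ^+ n = n%:R * (x * x ^+ n.-1).
  by case: n {IH} => [|n]; rewrite ?mul0r// exprS.
transitivity ((1 - x) * (\sum_(j < n) c j * (j%:R * x ^+ j.-1)) -
    alpha * partial_sum n x + c n * (n%:R * x ^+ n.-1) -
    c n * (n%:R * (x * x ^+ n.-1)) - alpha * c n * x ^+ n); first by ring.
by rewrite IH -E; ring.
Qed.

Let weight_ge0 n : 0 <= (alpha + n%:R) * c n.
Proof.
by apply: mulr_ge0; [rewrite addr_ge0// ltW|exact: rising_binomial_ge0].
Qed.

Let tail_cvg0 x : 0 <= x < 1 -> (alpha + n%:R) * c n * x ^+ n @[n --> \oo] --> 0.
Proof.
move=> /andP[x0 x1].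
(* The ratio of consecutive terms is x (alpha + n + 1) / (n + 1), which is below (1 + x) / 2 < 1 as
   soon as n (1 - x) >= 2 alpha. *)
apply: (@cvg0_ratio _ _ ((1 + x) / 2) (Num.truncn (2 * alpha / (1 - x))).+1).
- by move=> n; exact: mulr_ge0 (weight_ge0 n) (exprn_ge0 n x0).
- by apply/andP; split; lra.
move=> n Nn.
have n1 : 2 * alpha <= n%:R * (1 - x).
  rewrite -ler_pdivrMr ?subr_gt0//; apply: (le_trans (ltW (truncnS_gt _))).
  by rewrite ler_nat.
rewrite -(@ler_pM2l _ n.+1%:R) ?ltr0n//.
have -> : n.+1%:R * ((alpha + n.+1%:R) * c n.+1 * x ^+ n.+1) =
    (alpha + n.+1%:R) * x * ((alpha + n%:R) * c n * x ^+ n).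
  rewrite exprS; transitivity ((alpha + n.+1%:R) * (n.+1%:R * c n.+1) * (x * x ^+ n)).
    by ring.
  by rewrite recurrence; ring.
rewrite [leRHS]mulrA; apply: ler_wpM2r; first exact: mulr_ge0 (weight_ge0 n) (exprn_ge0 n x0).
have ax : alpha * x <= alpha by rewrite ler_piMr// ltW.
by rewrite -natr1; lra.
Qed.

(** The partial sum times (1 - x)^alpha equals 1 at 0, and by [derive_identity] its derivative
    consists of the defect alone. The mean value theorem then bounds its distance to 1 by a multiple
    of (alpha + n) c_n x^n, which tends to 0. *)
Lemma negative_binomial_series x : 0 <= x < 1 ->
  series (fun n => c n * x ^+ n) @ \oo --> (1 - x) `^ (- alpha).
Proof.
move=> /[dup] x01 /andP[x0 x1].
have pow_derive y : y < 1 -> is_derive y 1 (fun y => expR (alpha * ln (1 - y)))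
    (- (alpha / (1 - y)) * (1 - y) `^ alpha).
  move=> y1; have y1' : 0 < 1 - y by rewrite subr_gt0.
  have d1 : is_derive y 1 (fun y : R => 1 - y) (- 1).
    apply: (is_derive_eq (is_deriveB (is_derive_cst (1 : R) y 1) (is_derive_id y 1))).
    by rewrite sub0r.
  have d2 := @is_derive1_comp _ (@ln R) (fun y => 1 - y) y _ _ (is_derive1_ln y1') d1.
  have d3 := is_derive1_mul (is_derive_cst alpha y 1) d2.
  have d4 := @is_derive1_comp _ expR (fun y => alpha * ln (1 - y)) y _ _
    (is_derive_expR _) d3.
  apply: (is_derive_eq d4).
  by rewrite /powR gt_eqF// mul0r add0r /cst; ring.
have powE y : y < 1 -> (1 - y) `^ alpha = expR (alpha * ln (1 - y)).
  by move=> y1; rewrite /powR gt_eqF// subr_gt0.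
have bound n : `|partial_sum n.+1 x * (1 - x) `^ alpha - 1| <=
    (1 - x)^-1 * ((alpha + n%:R) * c n * x ^+ n).
  pose g y := partial_sum n.+1 y * expR (alpha * ln (1 - y)).
  have gd y : y < 1 -> is_derive y 1 g
      (- ((1 - y) `^ alpha / (1 - y) * (n.+1%:R * c n.+1 * y ^+ n))).
    move=> y1; have y1' : 0 < 1 - y by rewrite subr_gt0.
    apply: (is_derive_eq (is_derive1_mul (partial_sum_derive n.+1 y) (pow_derive y y1))).
    rewrite -powE//; have := derive_identity n.+1 y; rewrite -pred_Sn.
    move: (\sum_(j < n.+1) _) (partial_sum n.+1 y) ((1 - y) `^ alpha) => s p w E.
    have -> : n.+1%:R * c n.+1 * y ^+ n = - ((1 - y) * s - alpha * p) by rewrite E opprK.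
    by field; rewrite gt_eqF.
  have [||xi xiI E] := @MVT_segment _ g (fun y =>
    - ((1 - y) `^ alpha / (1 - y) * (n.+1%:R * c n.+1 * y ^+ n))) 0 x x0.
  - by move=> y; rewrite in_itv/= => /andP[_ yx]; apply: gd; exact: lt_trans x1.
  - apply: derivable_within_continuous => y; rewrite in_itv/= => /andP[_ yx].
    by have [] := gd y (le_lt_trans yx x1).
  move: xiI; rewrite in_itv/= => /andP[xi0 xix].
  have xi1 := le_lt_trans xix x1.
  have g0E : g 0 = 1.
    rewrite /g subr0 ln1 mulr0 expR0 mulr1 /partial_sum big_ord_recl big1.
      by rewrite /rising_binomial big_ord0 fact0 divr1 expr0 mulr1 addr0.
    by move=> i _; rewrite expr0n/= mulr0.
  rewrite powE// -/(g x) -[X in g x - X]g0E E subr0 mulNr normrN recurrence ger0_norm; last first.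
    apply: mulr_ge0 => //; apply: mulr_ge0.
      by rewrite divr_ge0 ?powR_ge0// subr_ge0 ltW.
    exact: mulr_ge0 (weight_ge0 n) (exprn_ge0 n xi0).
  have w1 : (1 - xi) `^ alpha <= 1.
    rewrite powE// -[leRHS](@expR0 R) ler_expR mulr_ge0_le0 ?(ltW alpha0)//.
    by apply: ln_le0; lra.
  have i1 : (1 - xi)^-1 <= (1 - x)^-1.
    by rewrite lef_pV2 ?posrE ?subr_gt0// lerD2l lerN2.
  have p1 : xi ^+ n <= x ^+ n by rewrite lerXn2r.
  apply: (@le_trans _ _ ((1 - x)^-1 * ((alpha + n%:R) * c n * x ^+ n) * 1)); last first.
    by rewrite mulr1.
  have iv0 : 0 <= (1 - xi)^-1 by rewrite invr_ge0 subr_ge0 ltW.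
  apply: ler_pM => //.
  - apply: mulr_ge0; first by rewrite mulr_ge0 ?powR_ge0.
    exact: mulr_ge0 (weight_ge0 n) (exprn_ge0 n xi0).
  - apply: ler_pM => //.
    + by rewrite mulr_ge0 ?powR_ge0.
    + exact: mulr_ge0 (weight_ge0 n) (exprn_ge0 n xi0).
    + by apply: le_trans i1; rewrite ler_piMl.
    + by rewrite ler_wpM2l.
  - exact: ltW.
have cvg1 : partial_sum n.+1 x * (1 - x) `^ alpha @[n --> \oo] --> (1 : R).
  apply/cvgrPdist_le => e e0.
  have : (1 - x)^-1 * ((alpha + n%:R) * c n * x ^+ n) @[n --> \oo] --> (1 - x)^-1 * 0.
    by apply: cvgMr; exact: tail_cvg0.
  rewrite mulr0 => /cvgrPdist_le/(_ _ e0); apply: filterS => n.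
  rewrite sub0r normrN => h; rewrite distrC.
  apply: le_trans (bound n) (le_trans (ler_norm _) h).
rewrite -cvg_shiftS /=.
have -> : (fun n => series (fun j => c j * x ^+ j) n.+1) =
    fun n => partial_sum n.+1 x * (1 - x) `^ alpha * (1 - x) `^ (- alpha).
  apply/funext => n; rewrite -mulrA -powRD ?subrr; last first.
    by apply/implyP => _; rewrite gt_eqF// subr_gt0.
  by rewrite powRr0 mulr1 /series/= big_mkord.
have : partial_sum n.+1 x * (1 - x) `^ alpha * (1 - x) `^ (- alpha) @[n --> \oo]
    --> 1 * (1 - x) `^ (- alpha) by apply: cvgMl; exact: cvg1.
by rewrite mul1r.
Qed.

End negative_binomial_series.

Section g_density_measure.
Context {R : realType}.
Variables a alpha beta : R.
Hypotheses (a01 : 0 < a < 1) (alpha0 : 0 < alpha) (beta0 : 0 < beta).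

Let b := beta / a.
Let w j := rising_binomial alpha j * a `^ alpha * (1 - a) ^+ j.

Let a0 : 0 < a. Proof. by case/andP: a01. Qed.
Let a1 : a < 1. Proof. by case/andP: a01. Qed.
Let b0 : 0 < b. Proof. exact: divr_gt0. Qed.

Let w_ge0 j : 0 <= w j.
Proof.
rewrite /w mulr_ge0 ?exprn_ge0 ?subr_ge0 ?(ltW a1)//.
by rewrite mulr_ge0 ?powR_ge0 ?rising_binomial_ge0.
Qed.

Let h j x := w j * erlang_pdf j b x.

Let mh j : measurable_fun setT (h j : measurableTypeR R -> R).
Proof. by apply: measurable_funM => //; exact: measurable_erlang_pdf. Qed.

Let h_ge0 j x : 0 <= h j x.
Proof. by rewrite mulr_ge0// erlang_pdf_ge0. Qed.

Let mw : measurable_fun setT (cst (a `^ alpha) : R -> R).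
Proof. exact: measurable_cst. Qed.

Let mid : measurable_fun setT (id : R -> R). Proof. exact: measurable_id. Qed.

(* Lebesgue measure is declared on [measurableTypeR R], whose display is not
   that of [R]: its image under the identity moves it to [R]. *)
Let midR : measurable_fun setT (id : measurableTypeR R -> R).
Proof. exact: measurable_id. Qed.

(** Index 0 is the atom and index j >= 1 the Erlang term of shape j. Presenting g_a as a series of
    measures provides both sigma-additivity and termwise integration. *)
Let component (j : nat) : {measure set R -> \bar R} :=
  if j is i.+1 then weighted_image lebesgue_measure midR (mh i.+1) (h_ge0 i.+1)
  else weighted_image \d_(0 : R) mid mw (fun=> powR_ge0 a alpha).

Definition g_density_mixture := mseries component 0.
HB.instance Definition _ := Measure.on g_density_mixture.

Lemma g_density_mixtureE (B : set R) : measurable B ->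
  g_density_mixture B = gd_measure (g_density a alpha beta) B.
Proof.
move=> mB; rewrite /g_density_mixture /mseries nneseries_recl//.
rewrite /gd_measure /=; congr (_ + _)%E.
  exact: (integral_cst \d_(0 : R) mB (a `^ alpha)%:E).
rewrite -(nneseries_addn 1)//.
transitivity (\sum_(i <oo) \int[lebesgue_measure]_(x in B) (h i.+1 x)%:E)%E.
  by apply: eq_eseriesr => i _; rewrite addn1.
rewrite -integral_nneseries//; last 2 first.
- by move=> i; apply/measurable_EFinP/measurable_funTS; exact: mh.
- by move=> i x _; rewrite lee_fin.
apply: eq_integral => x _.
rewrite -(nneseries_addn (f := fun i => (h i x)%:E) 1); last first.
  by move=> i; rewrite lee_fin.
by apply: eq_eseriesr => i _; rewrite addn1.
Qed.

Lemma g_density_mixture_neg : g_density_mixture `]-oo, 0[%classic = 0%E.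
Proof.
rewrite g_density_mixtureE// /gd_measure /= diracE memNset/= ?in_itv/= ?ltxx//.
rewrite mule0 add0e integral0_eq// => x; rewrite /= in_itv/= => x0.
apply: eseries0 => i _ _.
by rewrite /erlang_pdf ltNge (ltW x0)/= mulr0.
Qed.

(** With b = beta / a and x = (1 - a) b / (b + theta), the terms integrate to a^alpha c_n x^n, the
    atom being the term n = 0. The sum is (a / (1 - x))^alpha, and 1 - x = a (beta + theta) / (beta
    + a theta). *)
Lemma g_density_mixture_laplace theta : 0 <= theta ->
  (\int[g_density_mixture]_x (expR (- (theta * x)))%:E =
   (((beta + a * theta) / (beta + theta)) `^ alpha)%:E)%E.
Proof.
move=> th0.
have md : measurable_fun setT (fun x : R => (expR (- (theta * x)))%:E).
  by apply/measurable_EFinP; exact: measurable_decay.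
have e0 (x : R) : (0 <= (expR (- (theta * x)))%:E)%E by rewrite lee_fin expR_ge0.
have bt0 : 0 < beta + theta by rewrite ltr_wpDr.
have bat0 : 0 < beta + a * theta by rewrite ltr_wpDr// mulr_ge0// ltW.
pose x := (1 - a) * (b / (b + theta)).
have x01 : 0 <= x < 1.
  have q1 : b / (b + theta) <= 1 by rewrite ler_pdivrMr ?ltr_wpDr// mul1r lerDl.
  have q0 : 0 < b / (b + theta) by rewrite divr_gt0// ltr_wpDr.
  apply/andP; split; first by rewrite mulr_ge0 ?(ltW q0)// subr_ge0 ltW.
  apply: (@le_lt_trans _ _ (1 - a)); last by rewrite ltrBlDr ltrDl.
  by rewrite ler_piMr// subr_ge0 ltW.
have xE : 1 - x = a * ((beta + theta) / (beta + a * theta)).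
  rewrite /x /b; field; by rewrite (gt_eqF a0)/= gt_eqF.
rewrite /g_density_mixture ge0_integral_measure_series//.
transitivity (\sum_(n <oo) (a `^ alpha * (rising_binomial alpha n * x ^+ n))%:E)%E.
  apply: eq_eseriesr => -[|i] _ /=.
    rewrite ge0_integral_weighted//.
    transitivity (\int[\d_(0%R : R)]_y
      ((expR (- (theta * y)))%:E * (a `^ alpha)%:E))%E => //.
    rewrite integral_dirac//; last by apply: emeasurable_funM.
    rewrite diracT mul1e mulr0 oppr0 expR0 mul1e expr0.
    by rewrite /rising_binomial big_ord0 fact0 divr1 !mulr1.
  rewrite ge0_integral_weighted//.
  transitivity (\int[lebesgue_measure]_y
     ((w i.+1)%:E * ((expR (- (theta * y)))%:E * (erlang_pdf i.+1 b y)%:E)))%E.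
    by apply: eq_integral => y _; rewrite /h /= -!EFinM; congr EFin; ring.
  rewrite ge0_integralZl_EFin//; last 2 first.
  - move=> y _; apply: mule_ge0 => //; rewrite lee_fin; exact: erlang_pdf_ge0.
  - apply: emeasurable_funM => //.
    by apply/measurable_EFinP; exact: measurable_erlang_pdf.
  rewrite erlang_laplace// -EFinM; congr EFin.
  by rewrite /w /x [((1 - a) * _) ^+ _]exprMn; ring.
apply: nneseries_EFin_cvg.
have -> : ((beta + a * theta) / (beta + theta)) `^ alpha =
    a `^ alpha * (1 - x) `^ (- alpha).
  set r := (beta + theta) / (beta + a * theta) in xE *.
  have r0 : 0 < r by rewrite divr_gt0.
  have s0 : 0 < (beta + a * theta) / (beta + theta) by rewrite divr_gt0.
  have sr : ((beta + a * theta) / (beta + theta)) `^ alpha * r `^ alpha = 1.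
    rewrite -(powRM _ (ltW s0) (ltW r0)) /r mulrA divfK ?gt_eqF//.
    by rewrite divff ?gt_eqF// powR1.
  have rn0 : r `^ alpha != 0 by rewrite gt_eqF// powR_gt0.
  rewrite powRN xE (powRM _ (ltW a0) (ltW r0)) invfM mulrA divff ?mul1r.
    by apply: (mulIf rn0); rewrite sr mulVf.
  by rewrite gt_eqF// powR_gt0.
have -> : series (fun n => a `^ alpha * (rising_binomial alpha n * x ^+ n)) =
    fun n => a `^ alpha * series (fun n => rising_binomial alpha n * x ^+ n) n.
  by apply/funext => n; rewrite /series/= mulr_sumr.
by apply: cvgMr; exact: negative_binomial_series.
Qed.

Lemma g_density_mixture_setT : g_density_mixture setT = 1%E.
Proof.
have := g_density_mixture_laplace (lexx 0).
rewrite mulr0 !addr0 divff ?gt_eqF// powR1 => <-.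
transitivity (\int[g_density_mixture]_x (cst 1%E x))%E.
  by rewrite integral_cst// mul1e.
by apply: eq_integral => x _; rewrite mul0r oppr0 expR0.
Qed.

HB.instance Definition _ := Measure_isProbability.Build _ _ _
  g_density_mixture g_density_mixture_setT.

End g_density_measure.

(** * Increments of the compound Poisson process *)

Lemma measurable_fun_nat_indexed d d' (T : measurableType d)
    (T' : measurableType d') (V : T -> nat) (F : nat -> T -> T') :
  measurable_fun setT V -> (forall n, measurable_fun setT (F n)) ->
  measurable_fun setT (fun x => F (V x) x).
Proof.
move=> mV mF _ B mB; rewrite setTI.
rewrite (_ : _ @^-1` B = \bigcup_n (V @^-1` [set n] `&` F n @^-1` B)).
  apply: bigcupT_measurable => n; apply: measurableI.
    by rewrite -[X in measurable X]setTI; exact: mV.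
  by rewrite -[X in measurable X]setTI; exact: mF.
apply/seteqP; split => x /=; first by exists (V x).
by move=> [n _ [<-]].
Qed.

(* The blocks [v i, v (i + 1)[, i < m, tile [0, v m[: g q is the index of the
   block containing q. *)
Lemma prod_blocks (R : comPzSemiRingType) (m : nat) (v : nat -> nat) :
  v 0 = 0%N -> (forall i, (i < m)%N -> (v i <= v i.+1)%N) ->
  exists g : nat -> nat, forall F : nat -> nat -> R,
    \prod_(i < m) \prod_(v i <= q < v i.+1) F i q =
    \prod_(0 <= q < v m) F (g q) q.
Proof.
move=> v0; elim: m => [_|m IH vm].
  by exists id => F; rewrite big_ord0 v0 big_geq.
have [|g gE] := IH; first by move=> i im; exact/vm/ltnW.
exists (fun q => if (q < v m)%N then g q else m) => F.
rewrite big_ord_recr/= gE [RHS](@big_cat_nat _ _ _ (v m)) ?vm//=.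
congr (_ * _).
  by rewrite !big_nat; apply: eq_bigr => q /andP[_ ->].
by rewrite !big_nat; apply: eq_bigr => q /andP[+ _]; rewrite ltnNge => ->.
Qed.

Lemma sigma_generated_bigcap d d' (T : measurableType d)
    (T' : measurableType d') (I J : Type) (D : set I) (X : I -> T -> T')
    (s : seq J) (i : J -> I) (B : J -> set T') :
  (forall j, D (i j)) -> (forall j, measurable (B j)) ->
  sigma_generated D X (\big[setI/setT]_(j <- s) (X (i j) @^-1` B j)).
Proof.
move=> iD mB; rewrite /sigma_generated; set G := [set A | _].
pose GT : measurableType _ := g_sigma_algebraType G.
apply: (big_ind (fun A => <<s G >> A)).
- exact: (@measurableT _ GT).
- by move=> A1 A2; exact: (@measurableI _ GT).
- by move=> j _; apply: sub_sigma_algebra; exists (i j), (B j).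
Qed.

Section compound_poisson_laplace.
Context d (R : realType) (Omega : measurableType d) (P : probability Omega R).
Variables (lambda beta : R) (N : R -> {RV P >-> nat}) (J : nat -> {RV P >-> R}).
Hypotheses (lambda0 : 0 < lambda) (beta0 : 0 < beta).
Hypothesis hN : poisson_process lambda N.
Hypothesis hJ : iid_exponential beta J.
Hypothesis hNJ : independent_sigma P (sigma_generated [set t | 0 <= t] N)
                                     (sigma_generated setT J).

Local Notation Z := (compound_poisson N J).

Lemma measurable_compound_poisson t : measurable_fun setT (Z t).
Proof.
apply: (measurable_fun_nat_indexed (V := N t)
  (F := fun n w => \sum_(q < n) J q w)); first exact: measurable_funP.
by move=> n; apply: measurable_sum => q; exact: measurable_funP.
Qed.

Variables (m : nat) (tau c : nat -> R).
Hypothesis tau0 : tau 0 = 0.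
Hypothesis tau_ndecr : {homo tau : i j / (i <= j)%N >-> i <= j}.
Hypothesis c_ge0 : forall i, 0 <= c i.

Let phi i := beta / (beta + c i).

Let phi_ge0 i : 0 <= phi i.
Proof. by rewrite divr_ge0 ?(ltW beta0)// addr_ge0 ?(ltW beta0). Qed.

Let tau_ge0 i : 0 <= tau i. Proof. by rewrite -tau0 tau_ndecr. Qed.

Let dN i w := (N (tau i.+1) w - N (tau i) w)%N.

Let mdN i : measurable_fun setT (dN i).
Proof. by apply: measurable_fun_subn; exact: measurable_funP. Qed.

Let dN_pgf i :
  (\int[P]_w (phi i ^+ dN i w)%:E =
   (expR (lambda * (tau i.+1 - tau i) * (phi i - 1)))%:E)%E.
Proof.
(* Cells of length 0 do occur, for instance when s = 0; their increment is identically 0 and is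
   treated apart, the Poisson law being available only for positive lengths. *)
have := tau_ndecr (leqnSn i); rewrite le_eqVlt => /orP[/eqP tauE|taulT].
  transitivity (\int[P]_w (cst 1%E w))%E.
    by apply: eq_integral => w _; rewrite /dN tauE subnn expr0.
  transitivity (1 * P setT)%E; first exact: integral_cst.
  by rewrite probability_setT mule1 tauE subrr mulr0 mul0r expR0.
apply: poisson_pgf => //; first by rewrite mulr_gt0// subr_gt0.
by case: hN => _ _ lawN n; exact: lawN.
Qed.

Let increments w := expR (- \sum_(i < m) c i * (Z (tau i.+1) w - Z (tau i) w)).

Let mincrements : measurable_fun setT increments.
Proof.
apply: measurableT_comp => //; apply: measurableT_comp => //.
apply: measurable_sum => i; apply: measurable_funM => //.
by apply: measurable_funB; exact: measurable_compound_poisson.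
Qed.

(** As [phi i] is the Laplace transform of one jump at [c i], this is the conditional expectation of
    [increments] given the counts: every jump falling in cell i contributes a factor [phi i]. *)
Let weights w := \prod_(i < m) phi i ^+ dN i w.

Let mweights : measurable_fun setT weights.
Proof.
rewrite /weights.
under eq_fun do rewrite -(big_mkord xpredT (fun i => phi i ^+ dN i _)).
apply: (@measurable_prod_comp _ _ _ _ _ _ dN mdN (fun i n => phi i ^+ n)).
by move=> i.
Qed.

Let int_weights : (\int[P]_w (weights w)%:E =
  (\prod_(i < m) expR (lambda * (tau i.+1 - tau i) * (phi i - 1)))%:E)%E.
Proof.
have f0 (i n : nat) : 0 <= phi i ^+ n by exact: exprn_ge0.
have mf i : measurable_fun setT (fun n : nat => phi i ^+ n) by [].
have := @integral_prod_independent _ _ R Omega nat P nat dN mdN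
  (fun i n => phi i ^+ n) _ mf f0 dN_pgf (index_iota 0 m) setT
  (iota_uniq _ _) measurableT.
rewrite probability_setT mul1e big_mkord => <-.
  by apply: eq_integral => w _; rewrite big_mkord.
move=> B mB; rewrite setTI mul1e.
case: hN => _ indep _.
exact: (indep tau (tau_ge0 0) tau_ndecr _ _ (iota_uniq _ _) mB).
Qed.

(** A finite function, so that its values form a countable type and [eq_integral_level_sets]
    applies. *)
Let counts w := [ffun i : 'I_m.+1 => N (tau i) w].

Let counts_preimage (v : {ffun 'I_m.+1 -> nat}) :
  counts @^-1` [set v] =
  \big[setI/setT]_(i <- index_enum 'I_m.+1) (N (tau i) @^-1` [set v i]).
Proof.
rewrite -bigcap_seq; apply/seteqP; split => w.
  by move=> /= <- i _; rewrite /= ffunE.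
move=> h /=; apply/ffunP => i; rewrite ffunE.
by apply: (h i); rewrite /= mem_index_enum.
Qed.

Let mcounts v : measurable (counts @^-1` [set v]).
Proof.
rewrite counts_preimage; elim/big_ind: _ => //; first exact: measurableI.
by move=> i _; rewrite -[X in measurable X]setTI; exact: measurable_funP.
Qed.

(** Once the counts are fixed, [increments] is a product over finitely many deterministic jump
    indices q of exponentials of J_q, the coefficient being that of the cell g q. The event fixing
    the counts is independent of the jumps, so each factor integrates to [phi (g q)]. *)
Let increments_eq_weights v :
  (\int[P]_(w in counts @^-1` [set v]) (increments w)%:E =
   \int[P]_(w in counts @^-1` [set v]) (weights w)%:E)%E.
Proof.
pose n i := v (inord i).
have nE (w : Omega) i : counts w = v -> (i <= m)%N -> N (tau i) w = n i.
  by move=> wv im; rewrite /n -wv ffunE inordK.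
(* Counts that do not start at 0 or that decrease somewhere have probability 0, and both integrals
   vanish. In the other case the truncated subtractions in [dN] are genuine. *)
have [[n0 n_ndecr]|bad] := pselect (n 0 = 0%N /\
    forall i, (i < m)%N -> (n i <= n i.+1)%N); last first.
  have P0 : P (counts @^-1` [set v]) = 0%E.
    apply/negligibleP => //.
    case: hN => -[A [mA PA0 Abad]] _ _; exists A; split => // w /= wv.
    apply: Abad => -[N0 Nmono _]; apply: bad; split.
      by rewrite -(nE w)// tau0 N0.
    move=> i im; rewrite -!(nE w)//; last exact: ltnW.
    by apply: Nmono => //; exact: tau_ndecr.
  by rewrite !null_set_integral//; apply/measurable_EFinP; exact: measurable_funTS.
have [g gE] := prod_blocks R n0 n_ndecr.
have incE w : counts w = v ->
    increments w = \prod_(0 <= q < n m) expR (- (c (g q) * J q w)).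
  move=> wv; rewrite -(gE (fun i q => expR (- (c i * J q w)))).
  rewrite /increments -sumrN expR_sum; apply: eq_bigr => i _.
  rewrite -expR_sum sumrN -mulr_sumr; congr (expR (- (_ * _))).
  rewrite /compound_poisson !(nE w)//; last exact: ltnW.
  rewrite -!(big_mkord xpredT (fun q => J q w)).
  by rewrite (@big_cat_nat _ _ _ (n i))//= ?n_ndecr// addrAC subrr add0r.
have weightE w : counts w = v -> weights w = \prod_(0 <= q < n m) phi (g q).
  move=> wv; rewrite -(gE (fun i q => phi i)); apply: eq_bigr => i _.
  by rewrite prodr_const_nat /dN !(nE w)// ltnW.
transitivity (P (counts @^-1` [set v]) * (\prod_(0 <= q < n m) phi (g q))%:E)%E;
    last first.
  rewrite muleC -integral_cst//; apply: eq_integral => w /set_mem wv.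
  by rewrite weightE.
transitivity (\int[P]_(w in counts @^-1` [set v])
    (\prod_(0 <= q < n m) expR (- (c (g q) * J q w)))%:E)%E.
  by apply: eq_integral => w /set_mem wv; rewrite incE.
have mJ q : measurable_fun setT (J q) by exact: measurable_funP.
have f0 q (x : R) : 0 <= expR (- (c (g q) * x)) by exact: expR_ge0.
have mf q : measurable_fun setT (fun x : R => expR (- (c (g q) * x))).
  exact: measurable_decay.
have fe q : (\int[P]_w (expR (- (c (g q) * J q w)))%:E = (phi (g q))%:E)%E.
  by apply: exponential_laplace => // B mB; exact: hJ.2.
apply: (@integral_prod_independent _ _ R Omega R P nat J mJ
  (fun q x => expR (- (c (g q) * x))) _ mf f0 fe); [exact: iota_uniq|exact: mcounts|].
(* The event on the counts belongs to the sigma-algebra of [N] and the cylinder event to that of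
   [J]; mutual independence of the jumps then splits the latter. *)
move=> B mB; rewrite -(hJ.1 _ _ (iota_uniq _ _) mB); apply: hNJ.
  by rewrite counts_preimage; apply: sigma_generated_bigcap => // i; exact: tau_ge0.
by rewrite bigcap_seq; exact: sigma_generated_bigcap.
Qed.

Lemma compound_poisson_laplace :
  (\int[P]_w (expR (- \sum_(i < m) c i * (Z (tau i.+1) w - Z (tau i) w)))%:E =
   (\prod_(i < m)
     expR (lambda * (tau i.+1 - tau i) * (beta / (beta + c i) - 1)))%:E)%E.
Proof.
rewrite -int_weights; apply: (eq_integral_level_sets mcounts).
- exact/measurable_EFinP/mincrements.
- exact/measurable_EFinP/mweights.
- by move=> w; rewrite lee_fin expR_ge0.
- by move=> w; rewrite lee_fin prodr_ge0// => i _; exact: exprn_ge0.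
- exact: increments_eq_weights.
Qed.

End compound_poisson_laplace.

(** * The transition kernel *)

Section affine_kernel.
Context {R : realType}.
Variables (m : probability R R) (a : R).

Let mshift y : measurable_fun setT (fun x : R => x + a * y).
Proof. exact: measurable_funD. Qed.

Let m1 : measurable_fun setT (cst 1 : R -> R).
Proof. exact: measurable_cst. Qed.

Definition affine_kernel (y : R) : {measure set R -> \bar R} :=
  weighted_image m (mshift y) m1 (fun=> ler01).

Lemma affine_kernelE y (B : set R) : measurable B ->
  affine_kernel y B = m ((fun x => x + a * y) @^-1` B).
Proof.
move=> mB; rewrite /affine_kernel /= /weighted_image.
transitivity (1 * m ((fun x => x + a * y)%R @^-1` B))%E; last by rewrite mul1e.
apply: (integral_cst m _ 1%E).
by rewrite -[X in measurable X]setTI; exact: mshift.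
Qed.

Let mgraph (B : set R) : measurable B ->
  measurable [set p : R * R | B (p.2 + a * p.1)].
Proof.
move=> mB; rewrite -[X in measurable X]setTI.
have mf : measurable_fun setT (fun p : R * R => p.2 + a * p.1).
  by apply: measurable_funD => //; exact: measurable_funM.
exact: mf.
Qed.

Let affine_kernel_measurable (B : set R) :
  measurable B -> measurable_fun setT (affine_kernel ^~ B).
Proof.
move=> mB; have := measurable_fun_xsection m (mgraph mB).
congr measurable_fun; apply/funext => y; rewrite affine_kernelE//=; congr (m _).
by apply/seteqP; split => x; rewrite /xsection /= inE.
Qed.

HB.instance Definition _ := isKernel.Build _ _ _ _ _
  affine_kernel affine_kernel_measurable.

Let affine_kernel_setT y : affine_kernel y setT = 1%E.
Proof. by rewrite affine_kernelE// preimage_setT probability_setT. Qed.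

HB.instance Definition _ := Kernel_isProbability.Build _ _ _ _ _
  affine_kernel affine_kernel_setT.

(** By uniqueness of product measures, (X, W) has law [distribution P X] times [m]. The event is a
    measurable set [C] of pairs, and its section at y in A has [m]-mass [affine_kernel y B]. *)
Lemma joint_affine_law d (Omega : measurableType d) (P : probability Omega R)
    (X : {RV P >-> R}) (W Y : Omega -> R) :
  measurable_fun setT W -> (forall w, Y w = W w + a * X w) ->
  (forall A B, measurable A -> measurable B ->
    P (X @^-1` A `&` W @^-1` B) = P (X @^-1` A) * m B)%E ->
  forall A B : set R, measurable A -> measurable B ->
  P (X @^-1` A `&` Y @^-1` B) =
  (\int[distribution P X]_(y in A) affine_kernel y B)%E.
Proof.
move=> mW YE indep A B mA mB.
have mX : measurable_fun setT X by exact: measurable_funP.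
have mpair : measurable_fun setT (fun w => (X w, W w)).
  exact/measurable_fun_pairP.
have mpre C : measurable C -> measurable ((fun w => (X w, W w)) @^-1` C).
  by move=> mC; rewrite -[X in measurable X]setTI; exact: mpair.
have mone : measurable_fun setT (cst 1 : Omega -> R) by exact: measurable_cst.
pose law : {measure set (R * R) -> \bar R} :=
  weighted_image P mpair mone (fun=> ler01).
have lawE C : measurable C -> law C = P ((fun w => (X w, W w)) @^-1` C).
  move=> mC; rewrite /law /= /weighted_image.
  transitivity (1 * P ((fun w => (X w, W w)) @^-1` C))%E; last by rewrite mul1e.
  exact: (integral_cst P (mpre _ mC) 1%E).
have prodE := @product_measure_unique _ _ _ _ _ (distribution P X) m law.
pose C := (A `*` setT) `&` [set p : R * R | B (p.2 + a * p.1)].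
have mC : measurable C.
  by apply: measurableI; [exact: measurableX|exact: mgraph].
have -> : X @^-1` A `&` Y @^-1` B = (fun w => (X w, W w)) @^-1` C.
  by apply/seteqP; split => w /=; rewrite /C /= YE => -[]//= [].
rewrite -lawE// -prodE//; last first.
  by move=> A' B' mA' mB'; rewrite lawE -?indep//; exact: measurableX.
rewrite /= /product_measure1 [RHS]integral_mkcond; apply: eq_integral => y _.
rewrite patchE /=; case: ifPn => yA.
  rewrite affine_kernelE//; congr (m _); move/set_mem : yA => yA.
  by apply/seteqP; split => x; rewrite /xsection /C /= inE => // -[].
transitivity (m set0); last exact: measure0.
congr (m _).
apply/seteqP; split => x //; rewrite /xsection /C /= inE => -[[yA' _] _].
by move: yA; rewrite mem_set.
Qed.

End affine_kernel.

(** * Translation of Lebesgue measure and of generalized densities *)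

Lemma lebesgue_measure_shift (R : realType) (c : R) (A : set R) : measurable A ->
  pushforward lebesgue_measure ((fun x : R => x + c) : R -> measurableTypeR R) A =
  lebesgue_measure A.
Proof.
move=> mA; apply/esym.
have mc : measurable_fun setT
    ((fun x : R => x + c) : measurableTypeR R -> measurableTypeR R).
  exact: measurable_funD.
have mpre (B : set (measurableTypeR R)) : measurable B ->
    measurable ((fun x : measurableTypeR R => x + c) @^-1` B).
  by move=> mB; rewrite -[X in measurable X]setTI; exact: mc.
have mone : measurable_fun setT (cst 1 : measurableTypeR R -> R).
  exact: measurable_cst.
pose nu : {measure set (measurableTypeR R) -> \bar R} :=
  weighted_image lebesgue_measure mc mone (fun=> ler01).
have nuE B : measurable B -> nu B = pushforward lebesgue_measure
    ((fun x : R => x + c) : R -> measurableTypeR R) B.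
  move=> mB; rewrite /nu /= /weighted_image /pushforward.
  transitivity (1 * lebesgue_measure ((fun x : R => x + c)%R @^-1` B))%E.
    exact: (integral_cst lebesgue_measure (mpre _ mB) 1%E).
  by rewrite mul1e.
rewrite -nuE//.
apply: (lebesgue_measure_unique (mu := nu)) => //= _ [[x y]] _ <-.
rewrite -/(nu _) nuE//.
rewrite /pushforward (_ : _ @^-1` _ = `]x - c, y - c]%classic).
  rewrite !lebesgue_measure_itv/= !lte_fin ltrD2r; case: ifP => // _.
  by rewrite -!EFinB; congr EFin; ring.
by apply/seteqP; split => z /=; rewrite !in_itv/= ltrBlDr lerBrDr.
Qed.

Lemma ge0_integral_lebesgue_shift (R : realType) (f : R -> \bar R) (c : R)
    (B : set R) :
  measurable_fun setT f -> (forall x, (0 <= f x)%E) -> measurable B ->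
  (\int[lebesgue_measure]_(x in B) f (x - c)%R =
   \int[lebesgue_measure]_(x in (fun x => x + c)%R @^-1` B) f x)%E.
Proof.
move=> mf f0 mB.
have mc : measurable_fun setT
    ((fun x : R => x + c) : measurableTypeR R -> measurableTypeR R).
  exact: measurable_funD.
have mfc : measurable_fun setT (fun x : measurableTypeR R => f (x - c)).
  by apply: measurableT_comp => //; exact: measurable_funB.
transitivity (\int[pushforward lebesgue_measure
    ((fun x : R => x + c)%R : measurableTypeR R -> measurableTypeR R)]_(x in B)
    f (x - c)%R)%E.
  by apply: eq_measure_integral => A mA _; apply/esym; exact: lebesgue_measure_shift.
rewrite (@ge0_integral_pushforward _ _ _ _ _ _ mc)//.
- by apply: eq_integral => x _ /=; rewrite addrK.
- exact: measurable_funTS.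
Qed.

Lemma gd_measure_shift (R : realType) (g : gdensity) (c : R) (B : set R) :
  measurable_fun setT (gd_ac g) -> (forall x, (0 <= gd_ac g x)%E) ->
  measurable B ->
  gd_measure (gd_shift g c) B = gd_measure g ((fun x : R => x + c) @^-1` B).
Proof.
move=> mg g0 mB; rewrite /gd_measure /= !diracE ge0_integral_lebesgue_shift//.
Qed.

Lemma measurable_g_density (R : realType) (a alpha beta : R) :
  0 <= a <= 1 -> 0 < alpha -> 0 < beta / a ->
  measurable_fun setT (gd_ac (g_density a alpha beta)).
Proof.
move=> /andP[a0 a1] alpha0 b0 /=; pose h j x := (rising_binomial alpha j *
  a `^ alpha * (1 - a) ^+ j * erlang_pdf j (beta / a) x)%:E.
have h0 j x : (0 <= h j x)%E.
  rewrite lee_fin mulr_ge0 ?erlang_pdf_ge0// mulr_ge0 ?exprn_ge0 ?subr_ge0//.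
  by rewrite mulr_ge0 ?powR_ge0 ?rising_binomial_ge0.
rewrite (_ : (fun x => _) = fun x => (\sum_(j <oo | j \in xpredT) h j.+1 x)%E).
  apply: ge0_emeasurable_sum => [j x _ _|j _]; first exact: h0.
  apply/measurable_EFinP; apply: measurable_funM => //.
  exact: measurable_erlang_pdf.
apply/funext => x; rewrite -(nneseries_addn (f := fun j => h j x) 1)//.
by apply: eq_eseriesr => j _; rewrite addn1.
Qed.

(** * Independence from a factorized joint Laplace transform *)

Lemma ae_ge0_measure0 d (R : realType) (Omega : measurableType d)
    (P : {measure set Omega -> \bar R}) (U : Omega -> R) :
  measurable_fun setT U -> {ae P, forall w, 0 <= U w} ->
  P (U @^-1` `]-oo, 0[) = 0%E.
Proof.
move=> mU U0; have mA : measurable (U @^-1` `]-oo, 0[%classic).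
  by rewrite -[X in measurable X]setTI; exact: mU.
apply/negligibleP => //; apply: negligibleS U0 => w /=.
by rewrite in_itv/= => Uw; apply/negP; rewrite -ltNge.
Qed.

(** Uniqueness is used twice. For fixed n, the measures sending A to E[e^(-nW); U in A] and to l(n)
    P(U in A) have the same transform in p. Then, for fixed A, the measures sending B to P(U in A, W
    in B) and to P(U in A) mu(B) have the same transform in n. *)
Lemma laplace_product_law d (R : realType) (Omega : measurableType d)
    (P : probability Omega R) (U W : Omega -> R) (mu : probability R R)
    (l : nat -> R) :
  measurable_fun setT U -> measurable_fun setT W ->
  {ae P, forall w, 0 <= U w} -> {ae P, forall w, 0 <= W w} ->
  mu `]-oo, 0[%classic = 0%E ->
  (forall n, \int[mu]_x (expR (- (n%:R * x)))%:E = (l n)%:E)%E ->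
  (forall p n, \int[P]_w (expR (- (p%:R * U w + n%:R * W w)))%:E =
    \int[P]_w (expR (- (p%:R * U w)))%:E * (l n)%:E)%E ->
  forall A B : set R, measurable A -> measurable B ->
  P (U @^-1` A `&` W @^-1` B) = (P (U @^-1` A) * mu B)%E.
Proof.
move=> mU mW U0 W0 mu0 lE prodE A B mA mB.
have PU0 := ae_ge0_measure0 mU U0; have PW0 := ae_ge0_measure0 mW W0.
have mpre (V : Omega -> R) C : measurable_fun setT V -> measurable C ->
    measurable (V @^-1` C).
  by move=> mV mC; rewrite -[X in measurable X]setTI; exact: mV.
have mdecay n : measurable_fun setT (fun x : R => (expR (- (n%:R * x)))%:E).
  by apply/measurable_EFinP; exact: measurable_decay.
have decay0 n (x : R) : (0 <= (expR (- (n%:R * x)))%:E)%E by rewrite lee_fin expR_ge0.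
have mdecayc n (V : Omega -> R) : measurable_fun setT V ->
    measurable_fun setT (fun w => expR (- (n%:R * V w))).
  by move=> mV; exact: (measurableT_comp (measurable_decay n%:R)).
have l0 n : 0 <= l n by rewrite -lee_fin -lE integral_ge0.
have PT : (\int[P]_w (expR (- (0%:R * U w)))%:E = 1)%E.
  transitivity (1 * P setT)%E; last by rewrite probability_setT mule1.
  rewrite -[RHS](integral_cst P measurableT 1%E).
  by apply: eq_integral => w _; rewrite mulr0n mul0r oppr0 expR0.
have WE n : (\int[P]_w (expR (- (n%:R * W w)))%:E = (l n)%:E)%E.
  rewrite -[RHS]mul1e -PT -prodE; apply: eq_integral => w _.
  by rewrite mulr0n mul0r add0r.
have UA n : (\int[P]_(w in U @^-1` A) (expR (- (n%:R * W w)))%:E =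
    (l n)%:E * P (U @^-1` A))%E.
  have mg := mdecayc n W mW.
  have g0 w : 0 <= expR (- (n%:R * W w)) by exact: expR_ge0.
  have ml : measurable_fun setT (cst (l n) : Omega -> R) by exact: measurable_cst.
  pose m1 : {measure set R -> \bar R} := weighted_image P mU mg g0.
  pose m2 : {measure set R -> \bar R} := weighted_image P mU ml (fun=> l0 n).
  have m2E C : measurable C -> m2 C = ((l n)%:E * P (U @^-1` C))%E.
    by move=> mC; exact: (integral_cst P (mpre _ _ mU mC) (l n)%:E).
  transitivity (m1 A) => //; rewrite -m2E//.
  apply: laplace_unique => //.
  - by rewrite /m1 /= /weighted_image preimage_setT WE ltry.
  - by rewrite m2E// preimage_setT probability_setT mule1 ltry.
  - rewrite /m1 /= /weighted_image null_set_integral//; first exact: mpre.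
    by apply/measurable_EFinP; exact: measurable_funTS.
  - by rewrite m2E// PU0 mule0.
  - move=> p; rewrite /m1 /m2 !ge0_integral_weighted//.
    transitivity (\int[P]_w (expR (- (p%:R * U w + n%:R * W w)))%:E)%E.
      by apply: eq_integral => w _; rewrite -EFinM -expRD opprD.
    rewrite prodE muleC -ge0_integralZl//; last 2 first.
    - by apply/measurable_EFinP; exact: mdecayc.
    - by rewrite lee_fin.
    by apply: eq_integral => w _; rewrite muleC.
have PUfin : (fine (P (U @^-1` A)))%:E = P (U @^-1` A).
  by rewrite fineK// fin_num_measure//; exact: mpre.
set q := fine _ in PUfin.
have q0 : 0 <= q by exact: fine_ge0.
have mid : measurable_fun setT (id : R -> R) by exact: measurable_id.
have mq : measurable_fun setT (cst q : R -> R) by exact: measurable_cst.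
have mi : measurable_fun setT (\1_(U @^-1` A) : Omega -> R).
  by apply: measurable_indic; exact: mpre.
have i0 w : 0 <= (\1_(U @^-1` A) : Omega -> R) w by [].
pose m1 : {measure set R -> \bar R} := weighted_image P mW mi i0.
pose m2 : {measure set R -> \bar R} := weighted_image mu mid mq (fun=> q0).
have m1E C : measurable C -> m1 C = P (U @^-1` A `&` W @^-1` C).
  by move=> mC; rewrite /m1 /= /weighted_image integral_indic//; exact: mpre.
have m2E C : measurable C -> m2 C = (q%:E * mu C)%E.
  by move=> mC; exact: (integral_cst mu mC q%:E).
rewrite -PUfin -m2E// -m1E//.
apply: laplace_unique => //.
- rewrite m1E// preimage_setT setIT.
  by rewrite -ge0_fin_numE// fin_num_measure//; exact: mpre.
- by rewrite m2E// probability_setT mule1 ltry.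
- rewrite m1E//; apply/eqP; rewrite -measure_le0 -PW0 le_measure ?inE//.
  + by apply: measurableI; exact: mpre.
  + exact: mpre.
- by rewrite m2E// mu0 mule0.
- move=> n; rewrite /m1 /m2 !ge0_integral_weighted//.
  transitivity (\int[P]_(w in U @^-1` A) (expR (- (n%:R * W w)))%:E)%E.
    by rewrite [RHS]integral_mkcond; apply: eq_integral => w _; rewrite epatch_indic.
  rewrite UA -PUfin -lE muleC -ge0_integralZl//.
  by apply: eq_integral => w _; rewrite muleC.
Qed.

(** * Transition law of the Gamma-OU process *)

Section gamma_OU_transition.
Context d (R : realType) (Omega : measurableType d) (P : probability Omega R).
Variables (k lambda beta x0 : R) (X : R -> {RV P >-> R}).
Variables (N : R -> {RV P >-> nat}) (J : nat -> {RV P >-> R}).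
Hypotheses (k0 : 0 < k) (lambda0 : 0 < lambda) (beta0 : 0 < beta).
Hypothesis hN : poisson_process lambda N.
Hypothesis hJ : iid_exponential beta J.
Hypothesis hNJ : independent_sigma P (sigma_generated [set t | 0 <= t] N)
                                     (sigma_generated setT J).
Local Notation Z := (compound_poisson N J).
Hypothesis hX : OU_solution k x0 Z X.

Let jumps_ge0 : {ae P, forall w, forall q, 0 <= J q w}.
Proof.
apply: ae_foralln => q.
exists (J q @^-1` `]-oo, 0[); split.
- by rewrite -[X in measurable X]setTI; exact: measurable_funP.
- transitivity (distribution P (J q) `]-oo, 0[) => //.
  rewrite hJ.2// /exponential_prob integral0_eq// => x /=.
  by rewrite in_itv/= => x_lt0; rewrite lt0_exponential_pdf.
- by move=> w /=; rewrite in_itv/= => /negP; rewrite -ltNge.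
Qed.

Let good_paths : {ae P, forall w,
  [/\ Z 0 w = 0,
      (forall s t, 0 <= s -> s <= t -> Z s w <= Z t w) &
      forall t, 0 <= t ->
        lebesgue_measure.-integrable `[0, t] (EFin \o X^~ w) /\
        X t w = x0 - k * \int[lebesgue_measure]_(u in `[0, t]) X u w + Z t w]}.
Proof.
case: hN => hN0 _ _.
apply: filterS3 hN0 jumps_ge0 hX => w [N0 Nmono _] J0 eqnX; split => //.
  by rewrite /compound_poisson N0 big_ord0.
move=> s t s0 st; rewrite /compound_poisson -!(big_mkord xpredT (fun q => J q w)).
rewrite [leRHS](@big_cat_nat _ _ _ (N s w)) ?Nmono//=.
by rewrite lerDl sumr_ge0.
Qed.

Let grid_sum u h n w := exp_grid_sum k (Z^~ w) u h n.

Let mgrid_sum u h n : measurable_fun setT (grid_sum u h n).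
Proof.
apply: measurable_sum => i; apply: measurable_funM => //.
by apply: measurable_funB; exact: measurable_compound_poisson.
Qed.

Let grid_sum_ge0 u h n w :
  (forall s t, 0 <= s -> s <= t -> Z s w <= Z t w) -> 0 <= u -> 0 <= h ->
  0 <= grid_sum u h n w.
Proof.
move=> Zmono u0 h0; apply: sumr_ge0 => i _; rewrite mulr_ge0 ?expR_ge0//.
rewrite subr_ge0 Zmono ?addr_ge0 ?mulr_ge0// lerD2l ler_wpM2r//.
by rewrite ler_nat.
Qed.

(** Laplace transform at [theta] of a grid sum with [n] cells of width [h]. *)
Let grid_laplace h theta n := \prod_(i < n)
  expR (lambda * h * (beta / (beta + theta * expR (- (k * ((n - i.+1)%:R * h)))) - 1)).

(** Both sums live on one grid of 2p cells, p of width h0 followed by p of width h1. The truncated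
    expressions in [tau] count the cells completed in each half, and [c] absorbs the exponential
    weights. Equal numbers of cells let a single limit refine both halves. *)
Let grid_sum_laplace (h0 h1 eta theta : R) p :
  0 <= h0 -> 0 <= h1 -> 0 <= eta -> 0 <= theta ->
  (\int[P]_w (expR (- (eta * grid_sum 0 h0 p w +
                       theta * grid_sum (p%:R * h0) h1 p w)))%:E =
   (grid_laplace h0 eta p * grid_laplace h1 theta p)%:E)%E.
Proof.
move=> h00 h10 eta0 theta0.
pose tau i := (minn i p)%:R * h0 + (i - p)%:R * h1.
pose c i := if (i < p)%N then eta * expR (- (k * ((p - i.+1)%:R * h0)))
  else theta * expR (- (k * ((p - (i - p).+1)%:R * h1))).
have tau0 : tau 0 = 0 by rewrite /tau min0n sub0n mulr0n !mul0r addr0.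
have tau_ndecr : {homo tau : i j / (i <= j)%N >-> i <= j}.
  move=> i j ij; rewrite lerD// ler_wpM2r// ler_nat; last exact: leq_sub2r.
  by rewrite leq_min geq_minr andbT (leq_trans (geq_minl _ _)).
have c_ge0 i : 0 <= c i by rewrite /c; case: ifP => _; rewrite mulr_ge0// expR_ge0.
have tauL i : (i <= p)%N -> tau i = i%:R * h0.
  by move=> ip; rewrite /tau (minn_idPl ip) (eqP ip) mulr0n mul0r addr0.
have tauR i : tau (p + i)%N = p%:R * h0 + i%:R * h1.
  by rewrite /tau (minn_idPr (leq_addr _ _)) addKn.
have stepL i : i.+1%:R * h0 - i%:R * h0 = h0 by rewrite -natr1; ring.
have stepR (b : R) i : b + i.+1%:R * h1 - (b + i%:R * h1) = h1.
  by rewrite -natr1; ring.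
have := compound_poisson_laplace lambda0 beta0 hN hJ hNJ (p + p) tau0 tau_ndecr c_ge0.
rewrite big_split_ord/=.
have -> : \prod_(i < p) expR (lambda * (tau i.+1 - tau i) *
    (beta / (beta + c i) - 1)) = grid_laplace h0 eta p.
  by apply: eq_bigr => i _; rewrite !tauL ?(ltnW (ltn_ord i))// stepL /c ltn_ord.
have -> : \prod_(i < p) expR (lambda * (tau (p + i).+1 - tau (p + i)%N) *
    (beta / (beta + c (p + i)%N) - 1)) = grid_laplace h1 theta p.
  apply: eq_bigr => i _; rewrite -addnS !tauR stepR /c ltnNge leq_addr/= addKn.
  by [].
move=> <-; apply: eq_integral => w _; congr ((expR (- _))%:E).
rewrite big_split_ord/= /grid_sum /exp_grid_sum !mulr_sumr; congr (_ + _).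
  apply: eq_bigr => i _; rewrite !tauL ?(ltnW (ltn_ord i))// /c ltn_ord !add0r.
  by rewrite mulrA.
apply: eq_bigr => i _; rewrite -addnS !tauR /c ltnNge leq_addr/= addKn.
by rewrite mulrA.
Qed.

Let grid_laplace0 h n : grid_laplace h 0 n = 1.
Proof.
rewrite /grid_laplace big1// => i _.
by rewrite mul0r addr0 divff ?gt_eqF// subrr mulr0 expR0.
Qed.

Let grid_laplace_cvg t theta : 0 <= t -> 0 <= theta ->
  grid_laplace (t / n.+1%:R) theta n.+1 @[n --> \oo] -->
  ((beta + expR (- (k * t)) * theta) / (beta + theta)) `^ (lambda / k).
Proof.
move=> t0 theta0; have bt0 : 0 < beta + theta by rewrite ltr_wpDr.
have bat0 : 0 < beta + expR (- (k * t)) * theta.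
  by rewrite ltr_wpDr// mulr_ge0// expR_ge0.
rewrite /powR gt_eqF ?divr_gt0// ln_div ?posrE// [expR (- (k * t)) * _]mulrC.
have -> : lambda / k * (ln (beta + theta * expR (- (k * t))) - ln (beta + theta)) =
    - lambda * ((ln (beta + theta) - ln (beta + theta * expR (- (k * t)))) / k).
  by ring.
pose S n := \sum_(j < n.+1) t / n.+1%:R *
  (theta * expR (- (k * (j%:R * (t / n.+1%:R)))) /
    (beta + theta * expR (- (k * (j%:R * (t / n.+1%:R)))))).
have SE n : grid_laplace (t / n.+1%:R) theta n.+1 = expR (- lambda * S n).
  rewrite /grid_laplace -expR_sum; congr expR.
  (* The weights of the grid sum decay with the distance to the right end, hence the reversal of
     indices before comparison with the Riemann sum. *)
  rewrite /S mulr_sumr (reindex_inj rev_ord_inj)/=; apply: eq_bigr => i _.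
  rewrite subnSK ?ltn_ord// subKn ?(ltnW (ltn_ord i))//.
  set e := theta * _; have e0 : 0 < beta + e.
    by rewrite ltr_wpDr// mulr_ge0// expR_ge0.
  by field; rewrite gt_eqF//= nat1r pnatr_eq0.
under eq_fun do rewrite SE.
apply: continuous_cvg; first exact: continuous_expR.
by apply: cvgMr; exact: log_riemann_sum.
Qed.

Variables s t : R.
Hypotheses (s0 : 0 <= s) (t0 : 0 <= t).

Let a := expR (- (k * t)).
Let U w := X s w - expR (- (k * s)) * x0.
Let W w := X (s + t) w - a * X s w.

Let mU : measurable_fun setT U.
Proof. by apply: measurable_funB => //; exact: measurable_funP. Qed.

Let mW : measurable_fun setT W.
Proof.
apply: measurable_funB; first exact: measurable_funP.
by apply: measurable_funM => //; exact: measurable_funP.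
Qed.

Let hs n := s / n.+1%:R : R.
Let ht n := t / n.+1%:R : R.

Let hs0 n : 0 <= hs n. Proof. exact: divr_ge0. Qed.
Let ht0 n : 0 <= ht n. Proof. exact: divr_ge0. Qed.
Let hsE n : n.+1%:R * hs n = s.
Proof. by rewrite /hs mulrCA divff ?mulr1// pnatr_eq0. Qed.

Let grid_cvg : {ae P, forall w, [/\
  forall n, 0 <= grid_sum 0 (hs n) n.+1 w,
  forall n, 0 <= grid_sum s (ht n) n.+1 w,
  grid_sum 0 (hs n) n.+1 w @[n --> \oo] --> U w &
  grid_sum s (ht n) n.+1 w @[n --> \oo] --> W w]}.
Proof.
apply: filterS good_paths => w [Z0 Zmono eqnX]; split.
- by move=> n; exact: grid_sum_ge0.
- by move=> n; exact: grid_sum_ge0.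
- have X0 : X 0 w = x0.
    have [_ ->] := eqnX 0 (lexx _).
    by rewrite Z0 set_itv1 Rintegral_set1 mulr0 subr0 addr0.
  have := @OU_grid_sum_cvg R k x0 (X^~ w) (Z^~ w) k0 Z0 Zmono eqnX 0 s (lexx _) s0.
  by rewrite add0r X0.
- exact: (@OU_grid_sum_cvg R k x0 (X^~ w) (Z^~ w) k0 Z0 Zmono eqnX s t s0 t0).
Qed.

Let U_ge0 : {ae P, forall w, 0 <= U w}.
Proof.
apply: filterS grid_cvg => w [S0 _ SU _].
by rewrite -(cvg_lim _ SU)//; apply: limr_ge; [exact: cvgP SU|exact: nearW].
Qed.

Let W_ge0 : {ae P, forall w, 0 <= W w}.
Proof.
apply: filterS grid_cvg => w [_ S0 _ SW].
by rewrite -(cvg_lim _ SW)//; apply: limr_ge; [exact: cvgP SW|exact: nearW].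
Qed.

Let laplace_cvg eta theta : 0 <= eta -> 0 <= theta ->
  P.-integrable setT (fun w => (expR (- (eta * U w + theta * W w)))%:E) /\
  (grid_laplace (hs n) eta n.+1 * grid_laplace (ht n) theta n.+1)%:E
    @[n --> \oo] -->
  (\int[P]_w (expR (- (eta * U w + theta * W w)))%:E)%E.
Proof.
move=> eta0 theta0.
have mexp (f g : Omega -> R) : measurable_fun setT f -> measurable_fun setT g ->
    measurable_fun setT (fun w => (expR (- (eta * f w + theta * g w)))%:E).
  move=> mf mg; apply/measurable_EFinP; apply: measurableT_comp => //.
  apply: measurableT_comp => //.
  by apply: measurable_funD; exact: measurable_funM.
pose f n w := (expR (- (eta * grid_sum 0 (hs n) n.+1 w +
                        theta * grid_sum s (ht n) n.+1 w)))%:E.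
have mf n : measurable_fun setT (f n) by apply: mexp; exact: mgrid_sum.
have flim : {ae P, forall w, setT w -> f n w @[n --> \oo] -->
    (expR (- (eta * U w + theta * W w)))%:E}.
  apply: filterS grid_cvg => w [_ _ SU SW] _.
  apply: cvg_EFin; first exact: nearW.
  apply: continuous_cvg; first exact: continuous_expR.
  by apply: cvgN; apply: cvgD; exact: cvgMr.
have i1 : P.-integrable setT (fun=> 1%E) by exact: finite_measure_integrable_cst.
have f1 : {ae P, forall w n, setT w -> (`|f n w| <= 1)%E}.
  apply: filterS grid_cvg => w [S0 S1 _ _] n _.
  rewrite /f abse_EFin ger0_norm ?expR_ge0// lee_fin -[leRHS](@expR0 R) ler_expR.
  by rewrite oppr_le0 addr_ge0// mulr_ge0.
have [intf _ lim] := dominated_convergence measurableT mf (mexp _ _ mU mW) flim i1 f1.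
split => //.
have <- : (fun n => \int[P]_w f n w)%E =
    fun n => (grid_laplace (hs n) eta n.+1 * grid_laplace (ht n) theta n.+1)%:E.
  apply/funext => n.
  have := grid_sum_laplace n.+1 (hs0 n) (ht0 n) eta0 theta0.
  by rewrite hsE.
exact: lim.
Qed.

Let W_laplace theta := ((beta + a * theta) / (beta + theta)) `^ (lambda / k).

(** Taking theta = 0 identifies the limit of the first grid factor as the transform of U. The second
    factor has its own limit, so the joint transform is the product of the two limits. *)
Let laplace_UW eta theta : 0 <= eta -> 0 <= theta ->
  (\int[P]_w (expR (- (eta * U w + theta * W w)))%:E =
   \int[P]_w (expR (- (eta * U w)))%:E * (W_laplace theta)%:E)%E.
Proof.
move=> eta0 theta0.
have [intU cvgU] := laplace_cvg eta0 (lexx 0).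
have [intUW cvgUW] := laplace_cvg eta0 theta0.
have UE : (fun w => (expR (- (eta * U w + 0 * W w)))%:E) =
    fun w => (expR (- (eta * U w)))%:E.
  by apply/funext => w; rewrite mul0r addr0.
have gridE : (fun n => (grid_laplace (hs n) eta n.+1 * grid_laplace (ht n) 0 n.+1)%:E) =
    fun n => (grid_laplace (hs n) eta n.+1)%:E.
  by apply/funext => n; rewrite grid_laplace0 mulr1.
rewrite UE in intU cvgU; rewrite gridE in cvgU.
have finU := integrable_fin_num measurableT intU.
have cvgUW' : ((grid_laplace (hs n) eta n.+1)%:E *
      (grid_laplace (ht n) theta n.+1)%:E)%E @[n --> \oo] -->
    (\int[P]_w (expR (- (eta * U w)))%:E * (W_laplace theta)%:E)%E.
  apply: cvgeM => //; last first.
    by apply: cvg_EFin; [exact: nearW|exact: grid_laplace_cvg].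
  by rewrite -(fineK finU); exact: mule_def_fin.
exact: cvg_unique cvgUW cvgUW'.
Qed.

Lemma OU_conditional_gdensity : 0 < t ->
  conditional_gdensity (X (s + t)) (X s)
    (fun y => gd_shift (g_density a (lambda / k) beta) (a * y)).
Proof.
move=> t_gt0.
have alpha0 : 0 < lambda / k by rewrite divr_gt0.
have a01 : 0 < a < 1.
  by rewrite expR_gt0 -[ltRHS](@expR0 R) ltr_expR oppr_lt0 mulr_gt0.
have a0 : 0 < a by case/andP: a01.
pose mu : probability R R := g_density_mixture a01 alpha0 beta0.
have indepU := laplace_product_law (mu := mu) (l := fun n => W_laplace n%:R)
  mU mW U_ge0 W_ge0 (g_density_mixture_neg a01 alpha0 beta0)
  (fun n => g_density_mixture_laplace a01 alpha0 beta0 (ler0n R n))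
  (fun p n => laplace_UW (ler0n R p) (ler0n R n)).
exists (affine_kernel mu a); split.
  move=> y B mB; rewrite affine_kernelE//.
  rewrite gd_measure_shift//; last 2 first.
  - apply: measurable_g_density => //; last by rewrite divr_gt0.
    by have /andP[/ltW-> /ltW->] := a01.
  - move=> x /=; apply: nneseries_ge0 => j _ _; rewrite lee_fin.
    rewrite mulr_ge0 ?erlang_pdf_ge0 ?divr_gt0// mulr_ge0 ?exprn_ge0 ?subr_ge0//.
      by rewrite mulr_ge0 ?powR_ge0 ?rising_binomial_ge0.
    by have /andP[_ /ltW] := a01.
  apply: g_density_mixtureE.
  rewrite -[X in measurable X]setTI.
  have mshift : measurable_fun setT (fun x : R => x + a * y) by exact: measurable_funD.
  exact: mshift.
apply: (joint_affine_law (W := W)) => //.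
  by move=> w; rewrite /W subrK.
move=> A B mA mB.
(* [X s] differs from [U] by a constant, so events of one are events of the other. *)
have XU C : X s @^-1` C = U @^-1` ((fun u => u + expR (- (k * s)) * x0) @^-1` C).
  by apply/seteqP; split => w /=; rewrite /U subrK.
rewrite XU indepU// -[X in measurable X]setTI.
have mshift : measurable_fun setT (fun u : R => u + expR (- (k * s)) * x0).
  exact: measurable_funD.
exact: mshift.
Qed.

End gamma_OU_transition.

Theorem corollary2p5 (R : realType) (d : measure_display)
    (Omega : measurableType d) (P : probability Omega R)
    (k lambda beta x0 : R) (X : R -> {RV P >-> R}) :
  0 < k -> 0 < lambda -> 0 < beta ->
  gamma_OU k lambda beta x0 X ->
  forall s t : R, 0 <= s -> 0 < t ->
  let a := expR (- (k * t)) in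
  conditional_gdensity (X (t + s)) (X s)
    (fun y => gd_shift (g_density a (lambda / k) beta) (a * y)).
Proof.
move=> k0 lambda0 beta0 [N [J [hN hJ hNJ hX]]] s t s0 t0 a.
rewrite addrC; exact: (OU_conditional_gdensity k0 lambda0 beta0 hN hJ hNJ hX s0 (ltW t0) t0).
Qed.
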